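(* Let $k\geq 3$ and let $H$ be a $k$-graph. Then there exists an integer $n_0=n_0(H)$ such that for all $n\geq n_0$ with $n\equiv 0\pmod{k-1}$, $$R(C^{(k)}_{n,1},H)\leq (\chi(H)-1)(n-1)+4k\binom{\chi(H)-1}{2}+\tau(k-1,\sigma(H))+1.$$
   Context: A $k$-graph is a $k$-uniform hypergraph. $R(G,H)$ is the least $N$ such that every red/blue colouring of the edges of $K^{(k)}_N$ contains a red copy of $G$ or a blue copy of $H$. $\chi(H)$ is the least number of colours in a vertex colouring with no monochromatic edge; $\sigma(H)$ is the smallest possible size of a colour class in such a colouring using $\chi(H)$ colours. For $n=q(k-1)$, $q\ge1$, the loose cycle $C^{(k)}_{n,1}$ has vertices $v_1,\dots,v_n$ and edges $e_i=\{v_{(i-1)(k-1)+1},\dots,v_{i(k-1)+1}\}$ for $i\in[q]$, indices taken with $v_{n+1}=v_1$. For integers $j,\alpha\ge1$, $\tau(j,\alpha)$ is the largest $N$ such that some $j$-uniform hypergraph on $N$ vertices has independence number less than $\alpha$ and no two edges meeting in exactly one vertex. *)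

(* Defs.v *)
From mathcomp Require Import all_boot.
Set Implicit Arguments. Unset Strict Implicit. Unset Printing Implicit Defensive.

Definition uniform (V : finType) (k : nat) (E : {set {set V}}) : Prop :=
  forall e, e \in E -> #|e| = k.

(* Loose cycle C^{(k)}_{n,1}, vertices v_1..v_n encoded as 0..n-1 : 'I_n.
   The i-th edge (0-based i < n/(k-1)) is {v_{i(k-1)+1}, ..., v_{i(k-1)+k}},
   indices taken cyclically, i.e. the 0-based vertices (i(k-1)+t) mod n, t<k. *)
Definition loose_cycle (k n : nat) : {set {set 'I_n}} :=
  [set [set x : 'I_n | [exists t : 'I_k, nat_of_ord x == (i * (k - 1) + t) %% n]]
  | i : 'I_(n %/ (k - 1))].

(* Monochromatic copy of the hypergraph E (on V) of colour b in the 2-colouring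
   c of the k-subsets of 'I_N (c is a colouring of all subsets, only its values
   on the images of edges matter). *)
Definition mono_copy (V : finType) (E : {set {set V}}) (N : nat)
  (c : {set 'I_N} -> bool) (b : bool) : Prop :=
  exists f : V -> 'I_N, injective f /\ forall e, e \in E -> c (f @: e) = b.

Definition ramsey_prop (V W : finType) (G : {set {set V}}) (H : {set {set W}})
  (N : nat) : Prop :=
  forall c : {set 'I_N} -> bool, mono_copy G c true \/ mono_copy H c false.

Definition ramsey_le (V W : finType) (G : {set {set V}}) (H : {set {set W}})
  (M : nat) : Prop :=
  exists N, N <= M /\ ramsey_prop G H N.

Definition proper_col (V : finType) (E : {set {set V}}) (c : nat)
  (f : V -> 'I_c) : Prop :=
  forall e, e \in E -> exists x, exists y, [/\ x \in e, y \in e & f x != f y].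

Definition is_chi (V : finType) (E : {set {set V}}) (chi : nat) : Prop :=
  (exists f : V -> 'I_chi, proper_col E f) /\
  (forall c (f : V -> 'I_c), proper_col E f -> chi <= c).

Definition is_sigma (V : finType) (E : {set {set V}}) (s : nat) : Prop :=
  exists chi, is_chi E chi /\
  (exists f : V -> 'I_chi, proper_col E f /\
     exists i : 'I_chi, #|[set v | f v == i]| = s) /\
  (forall f : V -> 'I_chi, proper_col E f ->
     forall i : 'I_chi, s <= #|[set v | f v == i]|).

Definition independent (V : finType) (E : {set {set V}}) (S : {set V}) : Prop :=
  forall e, e \in E -> ~~ (e \subset S).

Definition tau_good (j a N : nat) (E : {set {set 'I_N}}) : Prop :=
  [/\ uniform j E,
      (forall S : {set 'I_N}, independent E S -> #|S| < a) &
      (forall e f, e \in E -> f \in E -> e != f -> #|e :&: f| != 1)].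

Definition is_tau (j a t : nat) : Prop :=
  (exists E : {set {set 'I_t}}, tau_good j a E) /\
  (forall N (E : {set {set 'I_N}}), tau_good j a E -> N <= t).

(* Main.v *)
(** Assume there is no red loose cycle [C_n] and no blue copy of [H].
By Ramsey's theorem every large set contains a red clique.  A "blob" is a red
clique (its core) together with a red loose path that starts and ends at the
core, whose number of edges can be prescribed within a long interval; closing
it through the core gives red loose cycles of many lengths.  Among [chi] cores
some crossing edge is red, and even two disjoint red edges meet the same two
cores, which merges two blobs into one and loses fewer than [k] vertices.
Adding fresh cliques and merging as long as possible leaves at most [chi - 1]
blobs covering all but boundedly many vertices, and counting shows that there
are exactly [chi - 1] of them, each of size close to [n]; two disjoint
connections between two such blobs would yield a red [C_n].

The cores must be large compared with the number of uncovered vertices, whereas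
a single pass leaves about [R] (a Ramsey number of the core size) of them.  So
the process is run twice: first with huge cliques, whose cores serve as hubs,
then outside the hubs with smaller cliques, and the blobs of the second run are
merged into the hubs.

Finally, absorb uncovered vertices by red paths of at most two edges with both
ends in one core; the path then becomes part of the body. When this is no
longer possible, delete one connection of at most two edges for every pair of
cores, and let [W] be the set of uncovered vertices that are left. Then [W] has
more than [tau] vertices. The [(k-1)]-sets [g] in [W] such that at least two
vertices [b] of one core make [b |: g] red form a hypergraph without two edges
meeting in exactly one vertex, since such a pair would be an absorbable path or
a connection. Hence it has an independent set of size [sigma], which together
with the cores carries a blue copy of [H]. *)
From mathcomp Require Import all_boot zify.
From Stdlib Require Import Classical.
Require Import Defs.
Set Implicit Arguments. Unset Strict Implicit. Unset Printing Implicit Defensive.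

(** * Hypergraph Ramsey theorem *)

(* [lia] preprocesses every boolean hypothesis, and membership facts make it
   exponentially slow; they never carry arithmetic information here. *)
Ltac nlia := repeat match goal with
  | H : is_true ?P |- _ => match P with context [in_mem _ _] => clear H end
  | H : is_true (negb _) |- _ => clear H
  | H : is_true (subset _ _) |- _ => clear H
  | H : is_true (disjoint _ _) |- _ => clear H
  | H : forall _, _ |- _ => clear H
  end; lia.

Lemma subset_of_card (T : finType) (A : {set T}) m :
  m <= #|A| -> exists2 B : {set T}, B \subset A & #|B| = m.
Proof.
move=> le_mA; exists [set x in take m (enum A)].
  by apply/subsetP=> x; rewrite inE => /mem_take; rewrite mem_enum.
rewrite cardsE; have /card_uniqP-> : uniq (take m (enum A)) by rewrite take_uniq ?enum_uniq.
by rewrite size_takel // -cardE.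
Qed.

Lemma card_cover_le (T : finType) (W : {set T}) (Y : nat -> {set T}) m t :
  (forall x, x \in W \/ exists2 i, i < t & x \in Y i) ->
  (forall i, i < t -> #|Y i| <= m) -> #|T| <= #|W| + t * m.
Proof.
elim: t W => [|t IH] W covW leY.
  by rewrite addn0 -cardsT subset_leq_card //; apply/subsetP=> x _; case: (covW x) => [//|[]].
have {}IH : #|T| <= #|W :|: Y t| + t * m.
  apply: IH => [x|i lti]; last by apply: leY; apply: ltnW.
  case: (covW x) => [Wx|[i]]; first by left; rewrite inE Wx.
  rewrite ltnS leq_eqVlt => /predU1P[->|lti] Yx; last by right; exists i.
  by left; rewrite inE Yx orbT.
have := leY t (ltnSn t); have := leq_card_setU (W :|: Y t) set0.
have [+ _] := leq_card_setU W (Y t); nlia.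
Qed.

(** Double induction, on the uniformity and then on [a + b]. Colouring the [k]-sets [e] by the
    colour of [x |: e] leaves a set on which all edges through [x] have one colour, so the target of
    that colour drops by one. *)
Lemma ramsey_cliques k a b : exists R, forall (T : finType) (c : {set T} -> bool) (X : {set T}),
  R <= #|X| ->
  (exists Y : {set T}, [/\ Y \subset X, #|Y| = a &
     forall e : {set T}, e \subset Y -> #|e| = k -> c e]) \/
  (exists Y : {set T}, [/\ Y \subset X, #|Y| = b &
     forall e : {set T}, e \subset Y -> #|e| = k -> ~~ c e]).
Proof.
elim: k a b => [|k IHk] a b.
  exists (a + b) => T c X leX; case c0: (c set0); [left|right].
    have [|Y sYX cY] := @subset_of_card _ X a; first nlia.
    by exists Y; split=> // e _ /cards0_eq ->.
  have [|Y sYX cY] := @subset_of_card _ X b; first nlia.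
  by exists Y; split=> // e _ /cards0_eq ->; rewrite c0.
have [m] := ubnP (a + b); elim: m a b => // m IHm [|a] [|b] ltm;
  try by exists 0 => T c X _; first [left; exists set0; split=> //; rewrite ?sub0set ?cards0 //;
   by move=> e; rewrite subset0 => /eqP->; rewrite cards0
   | right; exists set0; split=> //; rewrite ?sub0set ?cards0 //;
   by move=> e; rewrite subset0 => /eqP->; rewrite cards0].
have [|R1 hR1] := IHm a b.+1; first nlia.
have [|R2 hR2] := IHm a.+1 b; first nlia.
have [R hR] := IHk (maxn R1 R2) (maxn R1 R2); exists R.+1 => T c X ltR.
have /card_gt0P[x Xx] : 0 < #|X| by nlia.
have step (cc : pred {set T}) (Y Z : {set T}) : Y \subset X :\ x -> Z \subset Y ->
    (forall e : {set T}, e \subset Y -> #|e| = k -> cc (x |: e)) ->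
    (forall e : {set T}, e \subset Z -> #|e| = k.+1 -> cc e) ->
  [/\ x |: Z \subset X, #|x |: Z| = #|Z|.+1 &
      forall e : {set T}, e \subset x |: Z -> #|e| = k.+1 -> cc e].
  move=> sYX sZY ccY ccZ.
  have sZX := subset_trans sZY sYX; split.
  - by rewrite subUset sub1set Xx (subset_trans sZX) ?subsetDl.
  - rewrite cardsU1; case: (boolP (x \in Z)) => // /(subsetP sZX).
    by rewrite !inE eqxx.
  - move=> e se ce; case xe: (x \in e); last first.
      apply: ccZ => //; apply/subsetP=> y ye; move: (subsetP se y ye).
      by rewrite !inE; case/predU1P=> // eyx; rewrite -eyx ye in xe.
    rewrite -(setD1K xe); apply: ccY.
      apply: subset_trans sZY; apply/subsetP=> y; rewrite !inE => /andP[nyx ye].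
      by move: (subsetP se y ye); rewrite !inE (negPf nyx).
    by move: ce; rewrite (cardsD1 x e) xe => -[].
have [|[Y [sYX cY redY]]|[Y [sYX cY redY]]] := hR T (fun e => c (x |: e)) (X :\ x).
- by move: ltR; rewrite (cardsD1 x X) Xx.
- case: (hR1 T c Y); first by rewrite cY leq_maxl.
    case=> Z [sZY cZ redZ]; left; exists (x |: Z).
    by rewrite -cZ; apply: (step c) sYX sZY redY redZ.
  case=> Z [sZY cZ redZ]; right; exists Z; split=> //.
  by apply: subset_trans (subset_trans sYX (subsetDl _ _)).
- case: (hR2 T c Y); first by rewrite cY leq_maxr.
    case=> Z [sZY cZ redZ]; left; exists Z; split=> //.
    by apply: subset_trans (subset_trans sYX (subsetDl _ _)).
  case=> Z [sZY cZ redZ]; right; exists (x |: Z).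
  by rewrite -cZ; apply: (step (fun e => ~~ c e)) sYX sZY redY redZ.
Qed.

(** Greedy choice of one witness per pair. A later witness for the same pair that avoids [Z] is
    disjoint from the stored one; this is how pairs of disjoint links arise. *)
Lemma pick_links (T : finType) (r w : nat) (P : nat -> nat -> {set T} -> Prop) :
  (forall i j U, P i j U -> #|U| <= w) ->
  exists2 Z : {set T}, #|Z| <= w * 'C(r, 2) &
    forall i j U, i < j < r -> P i j U -> exists2 U0 : {set T}, U0 \subset Z & P i j U0.
Proof.
move=> leP; elim: r => [|r [Z cZ hZ]].
  by exists set0 => [|i j U]; rewrite ?cards0 ?ltn0 ?andbF.
suff [Z' cZ' hZ'] : exists2 Z' : {set T}, #|Z'| <= w * r &
    forall i U, i < r -> P i r U -> exists2 U0 : {set T}, U0 \subset Z' & P i r U0.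
  exists (Z :|: Z') => [|i j U /andP[ltij]].
    by rewrite binS bin1 mulnDr (leq_trans (leq_card_setU _ _)) ?leq_add.
  rewrite ltnS leq_eqVlt => /predU1P[ej|ltjr] PU.
    move: ltij PU; rewrite ej => ltir /(hZ' _ _ ltir)[U0 sU0 PU0].
    by exists U0 => //; apply: subset_trans sU0 (subsetUr _ _).
  have [|U0 sU0 PU0] := hZ i j U _ PU; first by rewrite ltij.
  by exists U0 => //; apply: subset_trans sU0 (subsetUl _ _).
have: r <= r by []; elim: {1 3 4}r => [|s IHs] les.
  by exists set0 => [|i U]; rewrite ?cards0 ?ltn0.
have [Z' cZ' hZ'] := IHs (ltnW les).
have [[U PU]|noU] := classic (exists U, P s r U); last first.
  exists Z' => [|i U]; first by rewrite (leq_trans cZ') // leq_mul2l leqnSn orbT.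
  rewrite ltnS leq_eqVlt => /predU1P[->|lti] PU; last exact: hZ' PU.
  by case: noU; exists U.
exists (Z' :|: U) => [|i U'].
  rewrite mulnSr (leq_trans (leq_card_setU _ _)) ?leq_add //; exact: leP PU.
rewrite ltnS leq_eqVlt => /predU1P[->|lti] PU'.
  by exists U => //; apply: subsetUr.
have [U0 sU0 PU0] := hZ' i U' lti PU'.
by exists U0 => //; apply: subset_trans sU0 (subsetUl _ _).
Qed.

(** * Loose paths and blobs *)

Section LoosePaths.

Variables (T : finType) (c : {set T} -> bool) (d : nat).

(* Edges have [d.+1] vertices, that is, [d = k - 1].  The list omits the first
   vertex, so that paths are composed by concatenation. *)
Inductive lpath : T -> seq T -> T -> Prop :=
| lpath_nil x : lpath x [::] x
| lpath_cons x t s y : size t = d -> c [set z in x :: t] ->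
    lpath (last x t) s y -> lpath x (t ++ s) y.

Lemma lpath_last x s y : lpath x s y -> last x s = y.
Proof. by elim=> {x s y} // x t s y _ _ _ <-; rewrite last_cat. Qed.

Lemma lpath_cat x s y s' z : lpath x s y -> lpath y s' z -> lpath x (s ++ s') z.
Proof.
elim=> {x s y} // x t s y st ct _ IH pz; rewrite -catA.
by apply: lpath_cons => //; apply: IH.
Qed.

Lemma lpath_rev x s y : lpath x s y -> lpath y (rev (belast x s)) x.
Proof.
elim=> {x s y} [x|x t s y st ct _ IH]; first exact: lpath_nil.
rewrite belast_cat rev_cat; apply: lpath_cat IH _; rewrite -(cats0 (rev _)).
have last_rev : last (last x t) (rev (belast x t)) = x.
  by case: t {st ct} => //= z t; rewrite rev_cons last_rcons.
apply: lpath_cons; first by rewrite size_rev size_belast.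
  by congr c: ct; apply/setP=> z; rewrite !in_set -(mem_rev (x :: t)) (lastI x t) rev_rcons.
by rewrite last_rev; apply: lpath_nil.
Qed.

Lemma lpath_edge x s y i : lpath x s y -> i * d < size s ->
  c [set z in take d.+1 (drop (i * d) (x :: s))].
Proof.
move=> p; elim: p i => {x s y} // x t s y st ct p IH i.
case: i => [_|i lti].
  by rewrite drop0 /= take_size_cat.
have -> : drop (i.+1 * d) (x :: t ++ s) = drop (i * d) (last x t :: s).
  rewrite mulSn addnC -drop_drop.
  by rewrite -cat_cons lastI cat_rcons drop_size_cat // size_belast.
by apply: IH; move: lti; rewrite mulSn size_cat st ltn_add2l.
Qed.

Definition linked (U : {set T}) x y q := exists s,
  [/\ lpath x s y, size s = q * d, uniq (x :: s) & {subset x :: s <= U}].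

Definition clique (A : {set T}) :=
  forall e : {set T}, e \subset A -> #|e| = d.+1 -> c e.

Lemma cliqueS (A B : {set T}) : A \subset B -> clique B -> clique A.
Proof. by move=> sAB cB e /subset_trans/(_ sAB); apply: cB. Qed.

Lemma linked_rev U x y q : linked U x y q -> linked U y x q.
Proof.
case=> s [ps cs us sU].
have e : y :: rev (belast x s) = rev (x :: s).
  by rewrite (lastI x s) rev_rcons (lpath_last ps).
exists (rev (belast x s)); split; rewrite ?e ?rev_uniq //.
- exact: lpath_rev.
- by rewrite size_rev size_belast.
- by move=> z; rewrite mem_rev; apply: sU.
Qed.

Lemma linked_mem U x y q : linked U x y q -> x \in U /\ y \in U.
Proof.
case=> s [ps _ _ sU]; split; apply: sU; first exact: mem_head.
by rewrite -(lpath_last ps) mem_last.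
Qed.

Lemma linked_cat (U V : {set T}) x y z q r : U :&: V \subset [set y] ->
  linked U x y q -> linked V y z r -> linked (U :|: V) x z (q + r).
Proof.
move=> sUV [s [ps cs us sU]] [s' [ps' cs' us' sV]]; exists (s ++ s'); split.
- exact: lpath_cat ps ps'.
- by rewrite size_cat cs cs' mulnDl.
- rewrite -cat_cons cat_uniq us; move: us' => /= /andP[ys' ->]; rewrite andbT.
  apply/hasPn=> w ws'; apply/negP=> ws; move: ys'.
  have /(subsetP sUV) : w \in U :&: V by rewrite inE sU // sV // inE ws' orbT.
  by rewrite inE => /eqP <-; rewrite ws'.
- move=> w; rewrite -cat_cons mem_cat in_setU => /orP[/sU->//|ws'].
  by rewrite (sV w) ?orbT // inE ws' orbT.
Qed.

Lemma lpath_clique A x s q : clique A -> size s = q * d -> uniq (x :: s) ->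
  {subset x :: s <= A} -> lpath x s (last x s).
Proof.
move=> cA; elim: q x s => [|q IH] x s.
  by move/size0nil-> => _ _; apply: lpath_nil.
rewrite mulSn => cs us sA; have szt : size (take d s) = d by rewrite size_takel // cs leq_addr.
rewrite -{1}(cat_take_drop d s); apply: lpath_cons => //.
  apply: cA.
    apply/subsetP=> z; rewrite !inE => /predU1P[->|/mem_take zs]; apply: sA;
      by rewrite inE ?eqxx ?zs ?orbT.
  rewrite cardsE; have /card_uniqP-> : uniq (x :: take d s); last by rewrite /= szt.
  move: us => /= /andP[xs us]; rewrite take_uniq // andbT.
  by apply: contra xs; apply: mem_take.
have -> : last x s = last (last x (take d s)) (drop d s).
  by rewrite -{1}(cat_take_drop d s) last_cat.
have e : x :: s = belast x (take d s) ++ last x (take d s) :: drop d s.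
  by rewrite -cat_rcons -lastI /= cat_take_drop.
apply: IH; first by rewrite size_drop cs addKn.
  by move: us; rewrite e cat_uniq => /and3P[].
by move=> z zs; apply: sA; rewrite e mem_cat zs orbT.
Qed.

(* The cardinality makes a path with [q] edges cover [U]. *)
Definition flex (U : {set T}) x y lo q :=
  #|U| = q * d + 1 /\ forall q1, lo <= q1 <= q -> linked U x y q1.

Lemma flex_mem U x y lo q : lo <= q -> flex U x y lo q -> x \in U /\ y \in U.
Proof. by move=> le [_ /(_ q)]; rewrite le leqnn => /(_ isT)/linked_mem. Qed.

Lemma flex_rev U x y lo q : flex U x y lo q -> flex U y x lo q.
Proof. by case=> cU fU; split=> // q1 /fU/linked_rev. Qed.

Lemma flex_cat (U V : {set T}) x y z lo q lo' q' : lo <= q -> lo' <= q' ->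
  U :&: V \subset [set y] -> flex U x y lo q -> flex V y z lo' q' ->
  flex (U :|: V) x z (lo + lo') (q + q').
Proof.
move=> leq le' sUV fU fV; have [_ yU] := flex_mem leq fU; have [yV _] := flex_mem le' fV.
have eUV : U :&: V = [set y].
  by apply/eqP; rewrite eqEsubset sUV sub1set inE yU.
case: fU fV => [cU fU] [cV fV]; split.
  have := cardsUI U V; rewrite eUV cards1 cU cV; nlia.
(* The part in [V] gets as many edges as possible, at most [q'], once [U] has its minimum [lo]. *)
move=> q1 hq1; have -> : q1 = maxn lo (q1 - q') + (q1 - maxn lo (q1 - q')) by nlia.
by apply: linked_cat sUV _ _; [apply: fU|apply: fV]; nlia.
Qed.

Hypothesis d_gt1 : 1 < d.

(** Any ordering of [r * d + 1] vertices of a clique is a loose path, so it suffices to choose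
    [r * d - 1] inner vertices. *)
Lemma flex_clique (G : {set T}) x y q : clique G -> x \in G -> y \in G -> x != y ->
  0 < q -> #|G| = q * d + 1 -> flex G x y 1 q.
Proof.
move=> cG Gx Gy nxy q_gt0 szG; split=> // r /andP[r_gt0 ler].
have le_rd : r * d <= q * d by rewrite leq_mul2r ler orbT.
have rd_gt0 : 0 < r * d by rewrite muln_gt0 r_gt0 ltnW.
have szG' : #|G :\ x :\ y| + 2 = #|G|.
  rewrite (cardsD1 x G) Gx (cardsD1 y (G :\ x)) !inE eq_sym nxy Gy; nlia.
have [|B sB cB] := @subset_of_card _ (G :\ x :\ y) (r * d - 1); first nlia.
have subB z : z \in B -> [/\ z \in G, z != x & z != y].
  by move/(subsetP sB); rewrite !inE => /and3P[].
have szB : size (rcons (enum B) y) = r * d by rewrite size_rcons -cardE cB; nlia.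
have uB : uniq (x :: rcons (enum B) y).
  rewrite /= rcons_uniq enum_uniq mem_rcons inE (negPf nxy) /= !mem_enum andbT.
  by apply/andP; split; apply/negP=> /subB[]; rewrite eqxx.
have sBG : {subset x :: rcons (enum B) y <= G}.
  by move=> z; rewrite inE mem_rcons inE mem_enum => /or3P[/eqP->|/eqP->|/subB[]].
exists (rcons (enum B) y); split=> //.
by rewrite -{2}(last_rcons x (enum B) y); apply: lpath_clique szB uB sBG.
Qed.

Lemma flex_edge (e : {set T}) x y : c e -> #|e| = d.+1 -> x \in e -> y \in e ->
  x != y -> flex e x y 1 1.
Proof.
move=> ce sze xe ye nxy; apply: flex_clique => //; last by rewrite sze; nlia.
move=> e' se' sze'; suff -> : e' = e by [].
by apply/eqP; rewrite eqEcard se' sze sze' leqnn.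
Qed.

(** [A] is the core and [X] the body. The ends [a] and [b] lie in the body but still form a clique
    with the core, so the path can be closed or prolonged through core vertices. *)
Definition blob (A X : {set T}) lo q := exists a b,
  [/\ flex X a b lo q, [disjoint A & X], clique (a |: (b |: A)) & 0 < lo <= q].

(** The set [b |: (x |: F)] is a red edge from the old end [b] to [x], and [U] leads on to [y]. As
    [y] comes from the core, it forms a clique with [a] and the rest of the core and replaces [b] as
    an end. *)
Lemma blob_absorb A X lo q U x y lo' q' : blob A X lo q -> flex U x y lo' q' ->
  0 < lo' <= q' -> x \in A -> y \in A -> [disjoint U & X] -> d <= #|A :\: U| ->
  exists F : {set T}, [/\ F \subset A :\: U, #|F| = d - 1 &
    blob (A :\: U :\: F) (X :|: U :|: F) (lo + 1 + lo') (q + 1 + q')].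
Proof.
move=> [a [b [fX dAX cA /andP[lo_gt0 leq]]]] fU /andP[lo'_gt0 le'] Ax Ay dUX leA.
have [F sF cF] := @subset_of_card _ (A :\: U) (d - 1) ltac:(nlia).
have [Xa Xb] := flex_mem leq fX; have [Ux Uy] := flex_mem le' fU.
have subF z : z \in F -> (z \in A) && (z \notin U).
  by move/(subsetP sF); rewrite inE andbC.
have dAX' z : z \in A -> z \in X = false by move=> /(disjointFr dAX).
have dUX' z : z \in U -> z \in X = false by move=> /(disjointFr dUX).
have nbx : b != x by apply/eqP=> ebx; rewrite -ebx in Ax; rewrite dAX' in Xb.
have nbF : b \notin F by apply/negP=> /subF/andP[/dAX']; rewrite Xb.
have nxF : x \notin F by apply/negP=> /subF/andP[_]; rewrite Ux.
exists F; split=> //; exists a, y; split.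
- have -> : X :|: U :|: F = X :|: (b |: (x |: F)) :|: U.
    apply/setP=> z; rewrite !inE; case: eqP => [->|_]; first by rewrite Xb.
    by case: eqP => [->|_]; rewrite ?Ux ?orbT //=; case: (z \in U); rewrite ?orbT ?orbF.
  apply: (@flex_cat _ _ a x y) fU => //; first nlia.
    apply/subsetP=> z; rewrite !inE => /andP[/orP[Xz|/or3P[/eqP ez|//|Fz]] Uz].
    - by rewrite dUX' in Xz.
    - by rewrite -ez dUX' in Xb.
    - by move: (subF z Fz); rewrite Uz andbF.
  apply: (@flex_cat _ _ a b x) fX _ => //.
    apply/subsetP=> z; rewrite !inE => /andP[Xz /or3P[//|/eqP ez|Fz]].
      by rewrite ez dAX' in Xz.
    by case/andP: (subF z Fz) => /dAX'; rewrite Xz.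
  apply: flex_clique; rewrite ?inE ?eqxx ?orbT //.
    apply: cliqueS cA; apply/subsetP=> z; rewrite !inE.
    case/or3P=> [->|/eqP->|/subF/andP[->]]; rewrite ?Ax ?orbT //.
  by rewrite !cardsU1 !inE (negPf nbx) (negPf nbF) nxF cF; nlia.
- rewrite disjoints_subset; apply/subsetP=> z; rewrite !inE => /and3P[nF nU Az].
  by rewrite !negb_or nF nU dAX'.
- apply: cliqueS cA; apply/subsetP=> z; rewrite !inE.
  by case/or3P=> [->//|/eqP->|/and3P[_ _ ->]]; rewrite ?Ay !orbT.
- nlia.
Qed.

End LoosePaths.

(** Decides membership goals as propositional tautologies. Hypotheses are cleared first, so the
    facts needed must stand in the goal. *)
Ltac mem_cases := clear; repeat (match goal with

  | |- context [in_mem ?x ?A] => case: (in_mem x A) => //=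
  | |- context [eq_op ?x ?y] => case: (eq_op x y) => //= end).

(** * Merging two blobs along two disjoint connections *)

Section Splice.

Variables (T : finType) (c : {set T} -> bool) (d : nat).
Hypothesis d_gt1 : 1 < d.

(** The second blob becomes a path between two vertices of [A]: [U] from [x] to [y], an edge to [a],
    the body [X'] to [b], a path through the core [B] to [y'], and [U'] to [x']. The first blob
    absorbs it. The long way through [B] adds only one edge to the least length, and the gain of
    [13] keeps [3 * lo <= q] true when [j = j' = 1]. *)
Lemma blob_splice A X lo q B X' lo' q' U U' x y x' y' j j' :
  blob c d A X lo q -> blob c d B X' lo' q' ->
  flex c d U x y j j -> flex c d U' y' x' j' j' -> 0 < j -> 0 < j' ->
  [/\ x \in A, x' \in A, y \in B & y' \in B] ->
  [disjoint U & U'] -> [disjoint U :|: U' & X :|: X'] ->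
  [disjoint A :|: X & B :|: X'] ->
  d <= #|A :\: (U :|: U')| -> 20 * d <= #|B :\: (U :|: U')| ->
  exists (A1 X1 L : {set T}) q1, [/\ blob c d A1 X1 (lo + lo' + 3 + j + j') q1,
    q + q' + j + j' + 13 <= q1,
    A1 \subset A /\ #|A| <= #|A1| + #|A :&: (U :|: U')| + d,
    [/\ #|L| <= d, L \subset B & [disjoint L & A1 :|: X1]] &
    A1 :|: X1 :|: L = A :|: X :|: B :|: X' :|: U :|: U'].
Proof.
move=> blobA [a [b [fX' dBX' cB /andP[lo'_gt0 le']]]] fU fU' j_gt0 j'_gt0 [Ax Ax' By By'].
move=> dUU' dUX dAB leA leB; set BU := B :\: (U :|: U') in leB *.
have [Ux Uy] := flex_mem (leqnn j) fU; have [Uy' Ux'] := flex_mem (leqnn j') fU'.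
have [Xa Xb] := flex_mem le' fX'.
have [F2 sF2 cF2] := @subset_of_card _ BU (d - 1) ltac:(nlia).
have szBR : #|BU :\: F2| = #|BU| - (d - 1).
  by have := cardsD BU F2; rewrite (setIidPr sF2) cF2.
pose r := (#|BU :\: F2| + 1) %/ d.
have szr : r * d <= #|BU :\: F2| + 1 < r * d + d.
  have ltm : (#|BU :\: F2| + 1) %% d < d by rewrite ltn_mod; nlia.
  by have := divn_eq (#|BU :\: F2| + 1) d; rewrite -/r; nlia.
have r_ge : 18 < r by rewrite /r leq_divRL; nlia.
have rd_ge : 19 * d <= r * d by rewrite leq_mul2r r_ge orbT.
have [F3 sF3 cF3] := @subset_of_card _ (BU :\: F2) (r * d - 1) ltac:(nlia).
have facts z : [&& (z \in U) ==> ~~ [|| z \in U', z \in X | z \in X'],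
    (z \in U') ==> ~~ [|| z \in X | z \in X'],
    (z \in A :|: X) ==> ~~ [|| z \in B | z \in X'], (z \in B) ==> (z \notin X'),
    (z \in F2) ==> [&& z \in B, z \notin U & z \notin U'] &
    (z \in F3) ==> [&& z \in B, z \notin U, z \notin U' & z \notin F2]].
  apply/andP; split; last (apply/and5P; split); apply/implyP.
  - move=> Uz; rewrite (disjointFr dUU' Uz).
    by have := disjointFr dUX (subsetP (subsetUl _ _) _ Uz); rewrite inE => ->.
  - move=> Uz; have := disjointFr dUX (subsetP (subsetUr _ _) _ Uz).
    by rewrite inE => ->.
  - by move=> AXz; have := disjointFr dAB AXz; rewrite inE => ->.
  - by move=> Bz; rewrite (disjointFr dBX' Bz).
  - by move/(subsetP sF2); rewrite !inE negb_or => /andP[/andP[-> ->] ->].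
  - by move/(subsetP sF3); rewrite !inE negb_or => /and3P[-> /andP[-> ->] ->].
pose G2 := y |: (a |: F2); pose G3 := b |: (y' |: F3).
have fy := facts y; have fa := facts a; have fb := facts b; have fy' := facts y'.
rewrite !inE By Uy in fy; rewrite !inE Xa in fa; rewrite !inE Xb in fb.
rewrite !inE By' Uy' in fy'.
have sG2 : G2 \subset a |: (b |: B).
  apply/subsetP=> z; rewrite !inE; move: (facts z); rewrite !inE.
  by case: eqP => [->|_]; rewrite ?By ?orbT //; case: (z == a); mem_cases; rewrite !orbT.
have sG3 : G3 \subset a |: (b |: B).
  apply/subsetP=> z; rewrite !inE; move: (facts z); rewrite !inE.
  case: eqP => [->|_]; rewrite ?orbT //; case: eqP => [->|_]; rewrite ?By' ?orbT //.
  by mem_cases; rewrite !orbT.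
have fG2 : flex c d G2 y a 1 1.
  apply: flex_clique; rewrite ?inE ?eqxx ?orbT //; first exact: cliqueS sG2 cB.
    by apply: contraTneq Uy => ->; move: fa; mem_cases.
  rewrite !cardsU1 !inE cF2.
  have -> : y == a = false by apply/eqP=> eya; move: Uy fa; rewrite eya; mem_cases.
  have -> : y \in F2 = false by move: fy; mem_cases.
  have -> : a \in F2 = false by move: fa; mem_cases.
  by rewrite /=; nlia.
have fG3 : flex c d G3 b y' 1 r.
  have nby : b == y' = false by apply/eqP=> eby; move: Uy' fb; rewrite -eby; mem_cases.
  apply: flex_clique; rewrite ?inE ?eqxx ?orbT //; first exact: cliqueS sG3 cB.
  - by rewrite nby.
  - by nlia.
  rewrite !cardsU1 !inE cF3 nby.
  have -> : y' \in F3 = false by move: fy'; mem_cases.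
  have -> : b \in F3 = false by move: fb; mem_cases.
  by rewrite /=; nlia.
(* All disjointness facts in one boolean formula, which turns the set identities below into
   tautologies. *)
have all_facts z : [&& (z == y) ==> (z \in U), (z == a) ==> (z \in X'),
    (z == b) ==> (z \in X'), (z == y') ==> (z \in U') & (z == x) ==> (z \in A)] && 
    ([&& (z \in U) ==> ~~ [|| z \in U', z \in X | z \in X'],
    (z \in U') ==> ~~ [|| z \in X | z \in X'],
    ((z \in A) || (z \in X)) ==> ~~ [|| z \in B | z \in X'], (z \in B) ==> (z \notin X'),
    (z \in F2) ==> [&& z \in B, z \notin U & z \notin U'] &
    (z \in F3) ==> [&& z \in B, z \notin U, z \notin U' & z \notin F2]]).
  apply/andP; split; last by have := facts z; rewrite !inE.
  by apply/and5P; split; apply/implyP=> /eqP->.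
pose V1 := U :|: G2; pose V2 := V1 :|: X'; pose V3 := V2 :|: G3; pose V4 := V3 :|: U'.
have f1 : flex c d V1 x a (j + 1) (j + 1).
  apply: flex_cat fU fG2 => //; apply/subsetP=> z; rewrite !inE.
  by move: (all_facts z); mem_cases.
have f2 : flex c d V2 x b (j + 1 + lo') (j + 1 + q').
  apply: flex_cat f1 fX' => //; apply/subsetP=> z; rewrite !inE.
  by move: (all_facts z); mem_cases.
have f3 : flex c d V3 x y' (j + 1 + lo' + 1) (j + 1 + q' + r).
  apply: flex_cat f2 fG3; [by nlia|by nlia|apply/subsetP=> z; rewrite !inE].
  by move: (all_facts z); mem_cases.
have f4 : flex c d V4 x x' (j + 1 + lo' + 1 + j') (j + 1 + q' + r + j').
  apply: flex_cat f3 fU'; [by nlia|by nlia|apply/subsetP=> z; rewrite !inE].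
  by move: (all_facts z); mem_cases.
have AV4 : A :&: V4 = A :&: (U :|: U').
  by apply/setP=> z; rewrite !inE; move: (all_facts z); mem_cases.
have [F [sF cF blobA1]] : exists F : {set T}, [/\ F \subset A :\: V4, #|F| = d - 1 &
    blob c d (A :\: V4 :\: F) (X :|: V4 :|: F) (lo + 1 + (j + 1 + lo' + 1 + j'))
      (q + 1 + (j + 1 + q' + r + j'))].
  apply: blob_absorb blobA f4 _ Ax Ax' _ _ => //; first by nlia.
    rewrite disjoints_subset; apply/subsetP=> z; rewrite !inE.
    by move: (all_facts z); mem_cases.
  by rewrite cardsD AV4 -cardsD.
exists (A :\: V4 :\: F), (X :|: V4 :|: F), (BU :\: F2 :\: F3), (q + 1 + (j + 1 + q' + r + j')).
split.
- by congr (blob _ _ _ _ _ _): blobA1; nlia.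
- by nlia.
- split; first by apply/subsetP=> z; rewrite !inE => /and3P[].
  rewrite -AV4 -(cardsID V4 A) -(cardsID F (A :\: V4)) (setIidPr sF) cF; nlia.
- split; first by rewrite cardsD (setIidPr sF3) cF3; nlia.
    by apply/subsetP=> z; rewrite !inE => /and3P[_ _ /andP[]].
  rewrite disjoints_subset; apply/subsetP=> z; have /implyP := subsetP sF z.
  by rewrite !inE; move: (all_facts z); mem_cases.
apply/setP=> z; have /implyP := subsetP sF z; rewrite !inE; move: (all_facts z).
by mem_cases.
Qed.

End Splice.

(** * Closing a blob to a loose cycle *)

Lemma lpath_cycle N (c : {set 'I_N} -> bool) d x s q : 1 < d -> 0 < q ->
  lpath c d x s x -> size s = q * d -> uniq s ->
  mono_copy (loose_cycle d.+1 (q * d)) c true.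
Proof.
move=> d_gt1 q_gt0 ps szs us; have n_gt0 : 0 < q * d by rewrite muln_gt0 q_gt0; nlia.
have e := lastI x s; rewrite (lpath_last ps) in e.
set b := belast x s in e *; have szb : size b = q * d by rewrite size_belast.
have ub : uniq b.
  rewrite -(perm_uniq (s1 := s)) // -(perm_cons x) e perm_sym -perm_rcons //.
(* The index [q * d] wraps around to [0], where [b] has [x], the last vertex of the closed path. *)
have nth_b m : m <= q * d -> nth x b (m %% (q * d)) = nth x (x :: s) m.
  rewrite leq_eqVlt => /predU1P[->|ltm]; last by rewrite modn_small // e nth_rcons szb ltm.
  rewrite modnn e nth_rcons szb ltnn eqxx.
  by rewrite /b; case: (s) szs n_gt0 => //= <-; rewrite ltnn.
exists (fun i : 'I_(q * d) => nth x b i); split=> [i j eij|E /imsetP[i _ ->]].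
  by apply: val_inj; apply/eqP; rewrite -(nth_uniq x _ _ ub) ?szb ?ltn_ord // eij.
case: i => i lt_i; have lti : i < q by move: lt_i; rewrite subn1 mulnK //; nlia.
have le_id : i * d + d <= q * d by rewrite -mulSnr leq_mul2r lti orbT.
have ce : c [set z in take d.+1 (drop (i * d) (x :: s))].
  by apply: lpath_edge ps _; rewrite szs; clear -lti le_id d_gt1; lia.
rewrite -[RHS]ce; congr c; apply/setP=> z; rewrite in_set; apply/imsetP/idP.
  case=> v; rewrite inE /= subn1 => /existsP[t /eqP ev] ->.
  have let_ : i * d + t <= q * d by have := ltn_ord t; nlia.
  rewrite ev /= nth_b // -nth_drop -(@nth_take d.+1) //; apply: mem_nth.
  by rewrite size_takel ?ltn_ord // size_drop /= szs; nlia.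
move/(nthP x)=> [t]; rewrite size_take => ltt.
have {}ltt : t < d.+1 by apply: leq_trans ltt _; case: ltnP.
rewrite nth_take // nth_drop => <-.
exists (Ordinal (ltn_pmod (i * d + t) n_gt0)); last by rewrite /= nth_b //; nlia.
by rewrite inE /= subn1; apply/existsP; exists (Ordinal ltt).
Qed.

(** The body supplies [q1] edges from [a] to [b], the other [m - q1] return through the core. If the
    body can supply [m - 1], one edge closes the cycle; otherwise the whole body is used, and the
    total size guarantees enough core vertices. *)
Lemma blob_cycle N (c : {set 'I_N} -> bool) d A X lo q m : 1 < d ->
  blob c d A X lo q -> lo < m -> d <= #|A| -> m * d <= #|A| + #|X| ->
  mono_copy (loose_cycle d.+1 (m * d)) c true.
Proof.
move=> d_gt1 [a [b [fX dAX cA /andP[lo_gt0 leq]]]] ltlo leA leAX.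
have [Xa Xb] := flex_mem leq fX; have [szX linkX] := fX.
have [s [ps szs us sX]] := linkX lo ltac:(nlia).
have nab : a != b.
  rewrite -(lpath_last ps); case: s us szs {ps sX} => [_ /esym/eqP|z s /= /andP[nas _] _].
    by rewrite muln_eq0; nlia.
  by apply: contraNneq nas => ->; apply: mem_last.
have nA z : z \in X -> z \notin A by move/(disjointFl dAX) => ->.
pose q1 := minn q m.-1.
have lt_q1m : q1 < m by rewrite /q1; nlia.
have e_m : m * d = q1 * d + (m - q1) * d by rewrite -mulnDl subnKC // ltnW.
have [|G0 sG0 cG0] := @subset_of_card _ A ((m - q1) * d - 1).
  have [lemq|ltqm] := leqP m.-1 q.
    by rewrite (_ : m - q1 = 1); last (by rewrite /q1; nlia); nlia.
  by move: leAX; rewrite szX e_m (_ : q1 = q); [nlia|rewrite /q1; nlia].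
have md_gt0 : 0 < (m - q1) * d by rewrite muln_gt0; nlia.
have nG0 z : z \in X -> z \notin G0 by move/nA; apply: contra; apply: (subsetP sG0).
have [s1 [ps1 szs1 us1 sX1]] := linkX q1 ltac:(rewrite /q1; nlia).
have [||||||_ /(_ (m - q1)) fG] := @flex_clique _ c d d_gt1 (a |: (b |: G0)) b a (m - q1).
- by apply: cliqueS cA; rewrite !setUS.
- by rewrite !inE eqxx orbT.
- by rewrite !inE eqxx.
- by rewrite eq_sym.
- by nlia.
- by rewrite !cardsU1 !inE (negPf nab) nG0 // nG0 // cG0 /=; nlia.
have [|s2 [ps2 szs2 us2 sG]] := fG; first by rewrite leqnn andbT; nlia.
rewrite e_m -mulnDl; apply: (@lpath_cycle _ c d a (s1 ++ s2)) => //.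
- by nlia.
- exact: lpath_cat ps1 ps2.
- by rewrite size_cat szs1 szs2 mulnDl.
move: (us1) (us2) => /= /andP[nas1 us1'] /andP[nbs2 us2']; rewrite cat_uniq us1' us2' andbT.
apply/hasPn=> z zs2; apply/negP=> zs1.
have: z \in a |: (b |: G0) by apply: sG; rewrite inE zs2 orbT.
rewrite !inE => /or3P[/eqP ez|/eqP ez|Gz].
- by rewrite -ez zs1 in nas1.
- by rewrite -ez zs2 in nbs2.
- by have := sX1 z; rewrite inE zs1 orbT => /(_ isT)/nG0; rewrite Gz.
Qed.

(** * Crossing edges *)

Section Crossing.

Variables (N : nat) (c : {set 'I_N} -> bool) (k : nat).
Variables (V : finType) (H : {set {set V}}).
Hypothesis unifH : uniform k H.
Hypothesis no_blue : ~ mono_copy H c false.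

(** Embed colour class [i] into [S i]. This is not a blue copy, so some edge of [H] has a red image,
    which meets two parts because the colouring is proper. *)
Lemma crossing_edge chi (f : V -> 'I_chi) (S : nat -> {set 'I_N}) :
  proper_col H f -> (forall i j, i < j < chi -> [disjoint S i & S j]) ->
  (forall i : 'I_chi, #|[set v | f v == i]| <= #|S i|) ->
  exists e : {set 'I_N}, [/\ c e, #|e| = k,
    forall x, x \in e -> exists2 i, i < chi & x \in S i &
    exists i j, i < j < chi /\
      (exists2 x, x \in e & x \in S i) /\ (exists2 x, x \in e & x \in S j)].
Proof.
move=> propf dS leS.
have ex v : exists x, x \in S (f v).
  by apply/card_gt0P; apply: leq_trans (leS (f v)); apply/card_gt0P; exists v; rewrite inE.
have [x0 _] : exists x0 : V -> 'I_N, True by exists (fun v => xchoose (ex v)).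
pose g v := nth (x0 v) (enum (S (f v))) (index v (enum [set w | f w == f v])).
have lt_ind v : index v (enum [set w | f w == f v]) < size (enum (S (f v))).
  rewrite -cardE; apply: leq_trans (leS (f v)); rewrite cardE index_mem.
  by rewrite mem_enum inE.
have gS v : g v \in S (f v) by rewrite -mem_enum; apply: mem_nth.
have injg : injective g.
  move=> v w egvw; have efvw : f v = f w.
    apply/eqP; apply: contraT => nef.
    have [ltvw|ltwv|/val_inj ev] := ltngtP (f v) (f w); last by rewrite ev eqxx in nef.
      have := disjointFr (dS (f v) (f w) _) (gS v); rewrite ltvw ltn_ord => /(_ isT).
      by rewrite egvw gS.
    have := disjointFr (dS (f w) (f v) _) (gS w); rewrite ltwv ltn_ord => /(_ isT).
    by rewrite -egvw gS.
  have := egvw; rewrite /g -efvw (set_nth_default (x0 v) (x0 w)); last first.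
    by have := lt_ind w; rewrite -efvw.
  move/eqP; rewrite nth_uniq ?enum_uniq //; last by have := lt_ind w; rewrite -efvw.
  by move/eqP; apply: (index_inj v); rewrite mem_enum inE ?efvw.
have [[e He ce]|allblue] := classic (exists2 e, e \in H & c (g @: e)); last first.
  case: no_blue; exists g; split=> // e He; apply: contra_not_eq allblue.
  by move=> ce; exists e => //; case: (c _) ce.
exists (g @: e); split=> //; first by rewrite card_imset // unifH.
  by move=> _ /imsetP[v _ ->]; exists (f v).
have [v [w [ve we nfvw]]] := propf e He.
wlog ltvw : v w ve we nfvw / f v < f w => [IH|].
  have [|ltwv|/val_inj evw] := ltngtP (f v) (f w); first exact: IH.
    by apply: (IH w v); rewrite 1?eq_sym.
  by rewrite evw eqxx in nfvw.
exists (f v), (f w); rewrite ltvw ltn_ord; split=> //.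
by split; [exists (g v)|exists (g w)]; rewrite ?imset_f.
Qed.

(* Vertices in parts beyond [j] are excluded: the parts other than [i] and [j]
   that lose vertices to such an edge precede [j]. *)
Definition link (A : nat -> {set 'I_N}) i j (e : {set 'I_N}) :=
  [/\ c e, #|e| = k, forall x, x \in e -> exists2 l, l <= j & x \in A l,
    exists2 x, x \in e & x \in A i & exists2 x, x \in e & x \in A j].

(** Store one link for every pair that has one and delete the stored vertices, at most
    [k * 'C(chi, 2)]. A crossing edge of the remaining parts is a link disjoint from the stored link
    of its pair. *)
Lemma crossing_pair chi (f : V -> 'I_chi) (A : nat -> {set 'I_N}) :
  proper_col H f -> (forall i j, i < j < chi -> [disjoint A i & A j]) ->
  (forall i, i < chi -> k * 'C(chi, 2) + #|V| <= #|A i|) ->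
  exists p q e e', [/\ p < q < chi, link A p q e, link A p q e' & [disjoint e & e']].
Proof.
move=> propf dA leA.
have [|Z szZ hZ] := @pick_links _ chi k (fun p q => link A p q).
  by move=> i j U [_ ->].
have [||e [ce sze eA [i0 [j0 [ltij [ex ey]]]]]] := @crossing_edge chi f (fun i => A i :\: Z) propf.
- move=> i j ltij; apply: disjointWl (subsetDl _ _) _; apply: disjointWr (subsetDl _ _) _.
  exact: dA.
- move=> i; apply: leq_trans (max_card _) _; rewrite cardsD.
  have := leA i (ltn_ord i); have := subset_leq_card (subsetIr (A i) Z); nlia.
pose hit j := (j < chi) && [exists x in e, x \in A j].
have hit_j0 : hit j0.
  case: ey => x xe; rewrite inE => /andP[_ Ax]; rewrite /hit; apply/andP; split; first nlia.
  by apply/existsP; exists x; rewrite xe.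
have ub_hit j : hit j -> j <= chi by move/andP=> [/ltnW].
(* [j] is the last part met by the edge, as [link] demands. *)
have [j /andP[ltj /existsP[y /andP[ye Ay]]] jmax] := ex_maxnP (ex_intro hit j0 hit_j0) ub_hit.
case: ex => x xe; rewrite inE => /andP[_ Ax].
have lt_i0j : i0 < j by apply: leq_trans (jmax j0 hit_j0); case/andP: ltij.
have linke : link A i0 j e.
  split=> //; [|by exists x|by exists y].
  move=> z ze; have [l ltl] := eA z ze; rewrite inE => /andP[_ Az]; exists l => //.
  by apply: jmax; rewrite /hit ltl; apply/existsP; exists z; rewrite ze.
have [|e' se' linke'] := hZ i0 j e _ linke; first by rewrite lt_i0j.
exists i0, j, e, e'; rewrite lt_i0j ltj; split=> //.
rewrite disjoint_sym; apply: disjointWl se' _; rewrite disjoint_sym disjoints_subset.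
by apply/subsetP=> z /eA[l _]; rewrite !inE => /andP[].
Qed.

End Crossing.

(** * Families of blobs *)

Lemma blobS (T : finType) (c : {set T} -> bool) d (A A' X : {set T}) lo q :
  A' \subset A -> blob c d A X lo q -> blob c d A' X lo q.
Proof.
move=> sA [a [b [fX dAX cA leq]]]; exists a, b; split=> //.
  exact: disjointWl dAX.
by apply: cliqueS cA; rewrite !setUS.
Qed.

Section Families.

Variables (N : nat) (c : {set 'I_N} -> bool) (d m : nat).
Hypothesis d_gt1 : 1 < d.
Hypothesis no_red : ~ mono_copy (loose_cycle d.+1 (m * d)) c true.

(* Since [lo] is at most [(q + s) / 3], two blobs that are too short for a red cycle of
   length [m * d] still have a merged lower bound below [m]; so if the merged blob
   is long enough, it contains a red cycle of exactly that length.  The slack [s]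
   pays for absorbed paths, whose lengths are rigid. *)
Definition grown s A X := exists lo q, [/\ blob c d A X lo q, 3 * lo <= q + s & lo < m].

Lemma grown_card s A X : grown s A X -> d <= #|A| -> #|A| + #|X| < m * d.
Proof.
case=> lo [q [bAX _ ltlo]] leA; rewrite ltnNge; apply/negP=> leAX; apply: no_red.
exact: blob_cycle bAX ltlo leA leAX.
Qed.

Definition family s t (A X : nat -> {set 'I_N}) (W : {set 'I_N}) :=
  [/\ forall i, i < t -> grown s (A i) (X i),
      forall i j, i < j < t -> [disjoint A i :|: X i & A j :|: X j],
      forall i, i < t -> [disjoint W & A i :|: X i] &
      forall x, x \in W \/ exists2 i, i < t & x \in A i :|: X i].

Lemma family_inj s t A X W i j x : family s t A X W -> i < t -> j < t ->
  x \in A i :|: X i -> x \in A j :|: X j -> i = j.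
Proof.
move=> [_ dY _ _] lti ltj xi xj; have [ltij|ltji|//] := ltngtP i j.
  by move: xj; rewrite (disjointFr (dY i j _) xi) ?ltij.
by move: xi; rewrite (disjointFr (dY j i _) xj) ?ltji.
Qed.

Lemma family_core_body s t A X W i j x : family s t A X W -> i < t -> j < t ->
  x \in A i -> x \notin X j.
Proof.
move=> famA lti ltj xi; apply/negP=> xj; have [grA _ _ _] := famA.
have eij : i = j by apply: (family_inj (x := x) famA); rewrite // inE ?xi ?xj ?orbT.
have [lo [q [[a [b [_ dAX _ _]]] _ _]]] := grA i lti.
by move: xj; rewrite -eij (disjointFr dAX xi).
Qed.

(** The merged blob takes position [p] and position [q] disappears, so [bump q] gives the old index.
    Cores after [q] do not meet the two links, whence the factor [i < q]; the others lose at most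
    [3 * d] vertices to the links, and the merged one up to [d] more. *)
Lemma family_merge t A X W p q e e' :
  family 0 t.+1 A X W -> (forall i, i < t.+1 -> 24 * d <= #|A i|) ->
  p < q < t.+1 -> link c d.+1 A p q e -> link c d.+1 A p q e' -> [disjoint e & e'] ->
  exists A1 X1 W1, [/\ family 0 t A1 X1 W1,
    forall i, i < t -> A1 i \subset A (bump q i) /\
      #|A (bump q i)| <= #|A1 i| + 4 * d * (i < q),
    W \subset W1 /\ #|W1| <= #|W| + d &
    exists2 i, i < t & #|A p| + #|X p| + (#|A q| + #|X q|) <= #|A1 i| + #|X1 i| + d].
Proof.
move=> famA leA /andP[ltpq ltq].
move=> [ce sze eA [x xe Ax] [y ye Ay]] [ce' sze' e'A [x' xe' Ax'] [y' ye' Ay']] dee'.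
have ltp := ltn_trans ltpq ltq.
have [grA dY dW covA] := famA.
have inY i z : z \in A i -> z \in A i :|: X i by rewrite inE => ->.
have core_neq z w : z \in A p -> w \in A q -> z != w.
  move=> Az Aw; apply/eqP=> ezw; rewrite -ezw in Aw.
  by have := family_inj famA ltp ltq (inY _ _ Az) (inY _ _ Aw); nlia.
have [lo [r [bp le_lo lt_lo]]] := grA p ltp.
have [lo' [r' [bq le_lo' lt_lo']]] := grA q ltq.
have eeA z : z \in e :|: e' -> exists2 l, l <= q & z \in A l.
  by rewrite inE => /orP[/eA|/e'A].
have eeX z i : z \in e :|: e' -> i < t.+1 -> z \notin X i.
  by move=> /eeA[l lel Az] lti; apply: family_core_body famA _ lti Az; nlia.
have szee : #|e :|: e'| <= 3 * d.
  by apply: leq_trans (leq_card_setU _ _) _; rewrite sze sze'; nlia.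
have szD i : #|A i| <= #|A i :\: (e :|: e')| + 3 * d.
  rewrite -(cardsID (e :|: e') (A i)).
  by have := subset_leq_card (subsetIr (A i) (e :|: e')); nlia.
have [||||||A1 [X1 [L [r1 [b1 ler1 [sA1 szA1] [szL sL dL] eU]]]]] :=
  blob_splice d_gt1 bp bq (flex_edge d_gt1 ce sze xe ye (core_neq _ _ Ax Ay))
    (flex_rev (flex_edge d_gt1 ce' sze' xe' ye' (core_neq _ _ Ax' Ay'))) isT isT.
- by split.
- exact: dee'.
- rewrite disjoints_subset; apply/subsetP=> z zee.
  by rewrite !inE negb_or !eeX.
- by apply: dY; rewrite ltpq.
- by have := leA p ltp; have := szD p; nlia.
- by have := leA q ltq; have := szD q; nlia.
have inU z : (z \in A1 :|: X1 :|: L) =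
    [|| z \in A p :|: X p, z \in A q :|: X q | z \in e :|: e'].
  by rewrite eU !inE -!orbA.
have nL z : z \in A1 :|: X1 -> z \notin L.
  by move=> zA1; rewrite (disjointFl dL zA1).
pose B i := if bump q i == p then A1 else A (bump q i) :\: (e :|: e').
pose Z i := if bump q i == p then X1 else X (bump q i).
have lt_bump i : i < t -> bump q i < t.+1 by rewrite /bump; nlia.
have in_new i z : i < t -> z \in B i :|: Z i ->
    if bump q i == p then z \in A1 :|: X1
    else (z \in A (bump q i) :|: X (bump q i)) && (z \notin e :|: e').
  move=> lti; rewrite /B /Z; case: eqP => [_|_] //.
  rewrite in_setU in_setD => /orP[/andP[-> Az]|Xz]; first by rewrite inE Az.
  by rewrite in_setU Xz orbT /=; apply: contraL Xz => /eeX; apply; apply: lt_bump.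
have bump_p : bump q p = p by rewrite /bump leqNgt ltpq.
have lt_pt : p < t by nlia.
exists B, Z, (W :|: L); split.
- split.
  + move=> i lti; rewrite /B /Z; case: eqP => _; last first.
      have [l [s [bi les ltl]]] := grA _ (lt_bump i lti).
      by exists l, s; split=> //; apply: blobS bi; apply: subsetDl.
    (* The [13] edges gained give the ratio bound. Both old lengths are below [m - 24], for a longer
       body with its core would give a red cycle; so three times the new lower bound is below
       [3 * m]. *)
    exists (lo + lo' + 3 + 1 + 1), r1; split=> //; first by nlia.
    have [[? [? [[szXp _] _ _ _]]] [? [? [[szXq _] _ _ _]]]] := (bp, bq).
    have := grown_card (grA p ltp) ltac:(have := leA p ltp; nlia).
    have := grown_card (grA q ltq) ltac:(have := leA q ltq; nlia).
    have := leA p ltp; have := leA q ltq.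
    rewrite szXp szXq => leAq leAp ltmq ltmp.
    have : (r + 24) * d < m * d by nlia.
    have : (r' + 24) * d < m * d by nlia.
    rewrite !ltn_pmul2r; nlia.
  + move=> i j /andP[ltij ltj]; have lti := ltn_trans ltij ltj.
    rewrite disjoints_subset; apply/subsetP=> z /(in_new _ _ lti) zi.
    rewrite in_setC; apply/negP=> /(in_new _ _ ltj) zj; move: zi zj.
    have neij : bump q i != bump q j by apply/eqP=> ebb; move: ebb ltij; rewrite /bump; clear; lia.
    have [lbi lbj] := (lt_bump i lti, lt_bump j ltj).
    have away k : k < t -> bump q k != p -> z \in A1 :|: X1 ->
        (z \in A (bump q k) :|: X (bump q k)) && (z \notin e :|: e') -> False.
      move=> ltk nekp zA1 /andP[zk zee].
      have : z \in A1 :|: X1 :|: L by rewrite in_setU zA1.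
      rewrite inU (negPf zee) orbF => /orP[zp|zq].
        by rewrite (family_inj famA (lt_bump k ltk) ltp zk zp) eqxx in nekp.
      have := family_inj famA (lt_bump k ltk) ltq zk zq.
      by move/eqP; rewrite eq_sym (negPf (neq_bump _ _)).
    case: eqP => [ei|/eqP nei]; case: eqP => [ej|/eqP nej].
    * by rewrite ei ej eqxx in neij.
    * exact: away.
    * by move=> zi zA1; apply: away zA1 zi.
    * move=> /andP[zi _] /andP[zj _].
      by rewrite (family_inj famA lbi lbj zi zj) eqxx in neij.
  + move=> i lti; rewrite disjoint_sym disjoints_subset; apply/subsetP=> z.
    move/(in_new _ _ lti)=> zi; rewrite in_setC in_setU negb_or; move: zi.
    case: eqP => [ei|/eqP nei] => [zA1|/andP[zi zee]].
      rewrite nL // andbT; have : z \in A1 :|: X1 :|: L by rewrite in_setU zA1.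
      rewrite inU => /or3P[zp|zq|/eeA[l lel Az]].
      * by rewrite (disjointFl (dW p ltp) zp).
      * by rewrite (disjointFl (dW q ltq) zq).
      * by rewrite (disjointFl (dW l _) (inY _ _ Az)) //; nlia.
    rewrite (disjointFl (dW _ (lt_bump i lti)) zi) /=; apply/negP=> /(subsetP sL) Aqz.
    have := family_inj famA (lt_bump i lti) ltq zi (inY _ _ Aqz).
    by move/eqP; rewrite eq_sym (negPf (neq_bump _ _)).
  + move=> z; have new_p : z \in A1 :|: X1 :|: L ->
        z \in W :|: L \/ exists2 i, i < t & z \in B i :|: Z i.
      rewrite in_setU => /orP[zA1|zL]; last by left; rewrite inE zL orbT.
      by right; exists p; rewrite // /B /Z bump_p eqxx.
    case: (covA z) => [Wz|[l ltl zl]]; first by left; rewrite inE Wz.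
    have [|] := boolP (z \in A1 :|: X1 :|: L); first exact: new_p.
    rewrite inU !negb_or => /and3P[nzp nzq nzee].
    have nelq : l != q by apply: contraNneq nzq => <-.
    have nelp : l != p by apply: contraNneq nzp => <-.
    have e_l : bump q (unbump q l) = l by apply: unbumpK; rewrite inE.
    right; exists (unbump q l); first by rewrite /unbump; move: nelq; clear -ltl ltq; lia.
    by rewrite /B /Z e_l (negPf nelp) in_setU in_setD nzee -in_setU.
- move=> i lti; rewrite /B; case: eqP => [ei|/eqP nei].
    rewrite ei; split=> //; have -> : i < q by move: ei ltpq; rewrite /bump; clear; lia.
    have := subset_leq_card (subsetIr (A p) (e :|: e')).
    by rewrite muln1; move: szA1; nlia.
  split; first exact: subsetDl.
  have [ltiq|leqi] := ltnP i q; first by rewrite muln1; have := szD (bump q i); nlia.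
  rewrite muln0 addn0; apply: subset_leq_card; rewrite subsetD subxx /=.
  rewrite disjoint_sym disjoints_subset; apply/subsetP=> z /eeA[l lel Az].
  rewrite in_setC; apply/negP=> Abz.
  have := family_inj famA _ (lt_bump i lti) (inY _ _ Az) (inY _ _ Abz).
  by rewrite /bump leqi; clear -lel leqi ltq; lia.
- split; first exact: subsetUl.
  by apply: leq_trans (leq_card_setU _ _) _; rewrite leq_add2l.
exists p => //; rewrite /B /Z bump_p eqxx.
have : #|(A p :|: X p) :|: (A q :|: X q)| <= #|A1 :|: X1 :|: L|.
  by apply/subset_leq_card/subsetP=> z; rewrite inU in_setU => /orP[->|->]; rewrite ?orbT.
have disjU (D E : {set 'I_N}) : [disjoint D & E] -> #|D :|: E| = #|D| + #|E|.
  by move=> dDE; rewrite cardsU disjoint_setI0 // cards0 subn0.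
have disj i : i < t.+1 -> [disjoint A i & X i].
  move=> lti; rewrite disjoints_subset; apply/subsetP=> z Az.
  by rewrite inE (family_core_body famA lti lti Az).
rewrite disjU ?dY ?ltpq // (disjU _ _ (disj p ltp)) (disjU _ _ (disj q ltq)).
have := leq_card_setU (A1 :|: X1) L; have := leq_card_setU A1 X1.
by move=> [+ _] [+ _]; move: szL; clear; lia.
Qed.

End Families.

Lemma blue_clique_copy N (c : {set 'I_N} -> bool) k (V : finType) (H : {set {set V}})
    (Y : {set 'I_N}) :
  uniform k H -> #|Y| = #|V| ->
  (forall e : {set 'I_N}, e \subset Y -> #|e| = k -> ~~ c e) -> mono_copy H c false.
Proof.
move=> unifH szY blueY; pose g v := enum_val (cast_ord (esym szY) (enum_rank v)).
have injg : injective g.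
  by move=> v w /enum_val_inj/cast_ord_inj/enum_rank_inj.
exists g; split=> // e He; apply/negbTE/blueY; last by rewrite card_imset // unifH.
by apply/subsetP=> _ /imsetP[v _ ->]; apply: enum_valP.
Qed.

(** * Covering all but boundedly many vertices by fewer than [chi] blobs *)

Section Bulk.

Variables (N : nat) (c : {set 'I_N} -> bool) (d m : nat).
Hypotheses (d_gt1 : 1 < d) (m_gt1 : 1 < m).
Hypothesis no_red : ~ mono_copy (loose_cycle d.+1 (m * d)) c true.

(** A body of [3 * d + 1] clique vertices has paths with one to three edges, just enough for
    [3 * lo <= q]. *)
Lemma grown_clique (Y S : {set 'I_N}) : clique c d Y -> S \subset Y -> #|S| = 3 * d + 1 ->
  grown c d m 0 (Y :\: S) S.
Proof.
move=> cY sS szS; have /card_gt1P[a [b [Sa Sb nab]]] : 1 < #|S| by rewrite szS; nlia.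
exists 1, 3; split=> //; exists a, b; split=> //.
- by apply: flex_clique => //; apply: cliqueS cY.
- by rewrite disjoint_sym disjoints_subset; apply/subsetP=> z Sz; rewrite !inE Sz.
- apply: cliqueS cY; apply/subsetP=> z; rewrite !inE.
  by case/or3P=> [/eqP->|/eqP->|/andP[]//]; apply: (subsetP sS).
Qed.

(** The position [s] matters: the first process inserts at [0], where merges may still damage the
    fresh core, and the transfer inserts at the end, behind the hubs. *)
Lemma family_insert t A X W s A0 X0 : s <= t -> family c d m 0 t A X W ->
  grown c d m 0 A0 X0 -> A0 :|: X0 \subset W ->
  family c d m 0 t.+1 (fun i => if i == s then A0 else A (unbump s i))
    (fun i => if i == s then X0 else X (unbump s i)) (W :\: (A0 :|: X0)).
Proof.
move=> les [grA dY dW covA] gr0 sW.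
have lt_un i : i < t.+1 -> i != s -> unbump s i < t by rewrite /unbump; clear -les; lia.
have dW0 i z : i < t -> z \in A0 :|: X0 -> z \notin A i :|: X i.
  by move=> lti /(subsetP sW) Wz; rewrite (disjointFr (dW i lti) Wz).
split.
- by move=> i lti; case: eqP => // /eqP nei; apply: grA; apply: lt_un.
- move=> i j /andP[ltij ltj]; have lti := ltn_trans ltij ltj.
  rewrite disjoints_subset; apply/subsetP=> z; rewrite in_setC.
  case: eqP => [ei|/eqP nei]; case: eqP => [ej|/eqP nej].
  + by rewrite ei ej ltnn in ltij.
  + exact/dW0/lt_un.
  + by apply: contraL; apply/dW0/lt_un.
  + move=> zi; rewrite (disjointFr (dY _ (unbump s j) _) zi) // lt_un // andbT.
    by move: nei nej ltij; rewrite /unbump; clear; lia.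
- move=> i lti; rewrite disjoints_subset; apply/subsetP=> z.
  rewrite in_setD in_setC => /andP[nz Wz]; case: eqP => // /eqP nei.
  by rewrite (disjointFr (dW _ (lt_un i lti nei)) Wz).
- move=> z; have [z0|nz0] := boolP (z \in A0 :|: X0).
    by right; exists s; rewrite ?ltnS ?eqxx.
  case: (covA z) => [Wz|[i lti zi]]; first by left; rewrite in_setD nz0.
  right; exists (bump s i); first by rewrite /bump; clear -lti les; lia.
  by rewrite eq_sym (negPf (neq_bump _ _)) bumpK.
Qed.

Variables (V : finType) (H : {set {set V}}) (chi : nat) (f : V -> 'I_chi).
Hypotheses (unifH : uniform d.+1 H) (propf : proper_col H f) (chi_gt0 : 0 < chi).
Hypothesis no_blue : ~ mono_copy H c false.

Lemma family_crossing t A X W : family c d m 0 t A X W -> t = chi ->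
  (forall i, i < chi -> d.+1 * 'C(chi, 2) + #|V| <= #|A i|) ->
  exists p q e e', [/\ p < q < chi, link c d.+1 A p q e, link c d.+1 A p q e' &
    [disjoint e & e']].
Proof.
move=> [_ dY _ _] et leA; apply: crossing_pair propf _ leA => // i j ltij.
apply: disjointWl (subsetUl _ (X i)) _; apply: disjointWr (subsetUl _ (X j)) _.
by apply: dY; rewrite et.
Qed.

(* The core in position [i] has lost at most [4 * d * i.+1] vertices: a merge of
   [p < q] damages only cores before position [q], and these move up by one
   position when [q] disappears, which frees position 0 for a fresh clique. *)
Lemma family_bulk M R (Res : {set 'I_N}) :
  d.+1 * 'C(chi, 2) + #|V| <= M -> 24 * d <= M ->
  (forall X : {set 'I_N}, R <= #|X| -> exists Y : {set 'I_N},
     [/\ Y \subset X, #|Y| = M + 4 * d * chi + (3 * d + 1) & clique c d Y]) ->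
  exists t A X W, [/\ t < chi, family c d m 0 t A X W, Res \subset W,
    #|W :\: Res| < R & forall i, i < t -> M <= #|A i|].
Proof.
move=> leM leM' ramR.
(* Induction on the number of uncovered vertices outside [Res]: a round removes a clique with more
   than [d] vertices from [W], and a merge returns at most [d]. *)
suff step w t A X W : #|W :\: Res| < w -> t < chi -> family c d m 0 t A X W ->
    Res \subset W -> (forall i, i < t -> M + 4 * d * chi <= #|A i| + 4 * d * i.+1) ->
    exists t A X W, [/\ t < chi, family c d m 0 t A X W, Res \subset W,
      #|W :\: Res| < R & forall i, i < t -> M <= #|A i|].
  apply: (step #|[set: 'I_N] :\: Res|.+1 0 (fun=> set0) (fun=> set0) setT) => //.
  by split=> // [i j|x]; [rewrite ltn0 andbF|left; rewrite inE].
elim: w t A X W => // w IH t A X W ltw ltt famA sRes leA.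
have [leR|ltR] := leqP R #|W :\: Res|; last first.
  exists t, A, X, W; split=> // i lti; have := leA i lti.
  have : 4 * d * i.+1 <= 4 * d * chi by rewrite leq_mul2l; apply/orP; right; nlia.
  by clear; lia.
have [Y [sY szY cY]] := ramR _ leR.
have [|S sS szS] := @subset_of_card _ Y (3 * d + 1); first nlia.
have eY : Y :\: S :|: S = Y.
  by apply/setP=> z; rewrite !inE; have /implyP := subsetP sS z; mem_cases.
have sYW : Y \subset W by apply: subset_trans sY (subsetDl _ _).
have famA' := family_insert (leq0n t) famA (grown_clique cY sS szS).
rewrite eY in famA'; move: {famA'} (famA' sYW).
set A' := (fun i => _); set X' := (fun i => _) => famA'.
have leA' i : i < t.+1 -> M + 4 * d * chi <= #|A' i| + 4 * d * i.
  rewrite /A'; case: i => [|i] /=; first by rewrite muln0 cardsD (setIidPr sS); nlia.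
  by rewrite ltnS /unbump /= subn1 /=; apply: leA.
have leMA' i : i < t.+1 -> M <= #|A' i|.
  move=> lti; have := leA' i lti.
  have : 4 * d * i <= 4 * d * chi by rewrite leq_mul2l; apply/orP; right; nlia.
  by clear; lia.
have sResY : Res \subset W :\: Y.
  apply/subsetP=> z Rz; rewrite in_setD (subsetP sRes) // andbT.
  by apply/negP=> /(subsetP sY); rewrite inE Rz.
have szW (W1 : {set 'I_N}) : Res \subset W1 -> #|W1| <= #|W :\: Y| + d -> #|W1 :\: Res| < w.
  move=> sR1 szW1; move: ltw; rewrite cardsD (setIidPr sRes) cardsD (setIidPr sR1).
  move: szW1; rewrite cardsD (setIidPr sYW).
  have := subset_leq_card sYW; have := subset_leq_card sResY.
  by rewrite cardsD (setIidPr sYW); nlia.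
have [ltt'|ge_t] := ltnP t.+1 chi.
  apply: (IH t.+1 A' X' (W :\: Y)) => //; first by apply: szW => //; nlia.
  by move=> i lti; apply: leq_trans (leA' i lti) _; rewrite leq_add2l leq_mul2l leqnSn orbT.
have et : t.+1 = chi by nlia.
have [|p [q [e [e' [/andP[ltpq ltq] le le' dee']]]]] := family_crossing famA' et.
  by move=> i; rewrite -{1}et => /leMA'; apply: leq_trans.
have [||A1 [X1 [W1 [famA1 sA1 [sW1 szW1] _]]]] := family_merge d_gt1 no_red famA' _ _ le le' dee'.
- by move=> i /leMA'; apply: leq_trans.
- by rewrite ltpq et.
have sRes1 := subset_trans sResY sW1.
apply: (IH t A1 X1 W1) => // [|i lti]; first exact: szW.
have [_] := sA1 i lti; have := leA' (bump q i) ltac:(rewrite /bump; nlia).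
rewrite mulnS /bump; case: ltnP => [ltiq|leqi].
  by rewrite add0n muln1; clear; lia.
by rewrite muln0 mulnDr muln1; clear; lia.
Qed.

End Bulk.

(** * Moving the blobs of the second run into the hubs *)

Section Transfer.

Variables (N : nat) (c : {set 'I_N} -> bool) (d m : nat).
Hypotheses (d_gt1 : 1 < d) (m_gt1 : 1 < m).
Hypothesis no_red : ~ mono_copy (loose_cycle d.+1 (m * d)) c true.
Variables (V : finType) (H : {set {set V}}) (chi : nat) (f : V -> 'I_chi).
Hypotheses (unifH : uniform d.+1 H) (propf : proper_col H f).
Hypothesis no_blue : ~ mono_copy H c false.

(** Each [B s] is placed behind the hubs, as part [r], and some pair [p < q] has two disjoint links.
    If [q < r], both links lie in cores of original hubs, and merging those would give a blob with
    at least [m * d] vertices, hence a red cycle. So [q = r], and [B s] goes into the hub [p]. *)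
Lemma family_transfer r A X W t B Z W2 M (Res : {set 'I_N}) :
  r.+1 = chi -> family c d m 0 r A X W ->
  (forall p q, p < q < r -> m * d + d <= #|A p| + #|X p| + (#|A q| + #|X q|)) ->
  family c d m 0 t B Z W2 ->
  (forall z, z \in Res <-> exists2 i, i < r & z \in A i) -> Res \subset W2 ->
  (forall j, j < t -> M <= #|B j|) ->
  (forall i, i < r -> M + (3 * d + 1) + 4 * d * t <= #|A i|) ->
  d.+1 * 'C(chi, 2) + #|V| <= M -> 24 * d <= M ->
  exists A' X' W', [/\ family c d m 0 r A' X' W', #|W'| <= #|W2 :\: Res| + t * d &
    forall i, i < r -> #|A i| <= #|A' i| + (3 * d + 1) + 4 * d * t].
Proof.
move=> er famA bigA famB ResP sRes leB leA leM leM'.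
(* The blobs still waiting for transfer; they count as uncovered in the new family but not in the
   bound. *)
pose Rest s := [set z | [exists j : 'I_t, (s <= j) && (z \in B j :|: Z j)]].
have RestP s z : z \in Rest s -> exists j, [/\ s <= j, j < t & z \in B j :|: Z j].
  by rewrite inE => /existsP[j /andP[lej zj]]; exists j; split.
suff step s : s <= t -> exists A' X' W', [/\ family c d m 0 r A' X' W',
    #|W' :\: Rest s| <= #|W2 :\: Res| + s * d,
    forall j, s <= j < t -> B j :|: Z j \subset W' &
    forall i, i < r -> A' i \subset A i /\ #|A i| <= #|A' i| + (3 * d + 1) + 4 * d * s].
  have [A' [X' [W' [famA' szW' _ szA']]]] := step t (leqnn t).
  exists A', X', W'; split=> // [|i lti]; last by case: (szA' i lti).
  suff e : W' :\: Rest t = W' by rewrite -{1}e.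
  apply/setP=> z; rewrite in_setD; suff -> : z \notin Rest t by [].
  by apply/negP=> /RestP[j [lej ltj _]]; rewrite leqNgt ltj in lej.
have [grA dY dW covA] := famA; have [grB dBY dWB covB] := famB.
elim: s => [_|s IH lts].
  (* The hubs start afresh as bare cliques: their old bodies are given up, because the second run
     has covered that space anew. *)
  pose S i := [set x in take (3 * d + 1) (enum (A i))].
  have sS i : S i \subset A i.
    by apply/subsetP=> x; rewrite inE => /mem_take; rewrite mem_enum.
  have szS i : i < r -> #|S i| = 3 * d + 1.
    move=> lti; rewrite cardsE; have /card_uniqP-> : uniq (take (3 * d + 1) (enum (A i))).
      by rewrite take_uniq ?enum_uniq.
    by rewrite size_takel // -cardE; have := leA i lti; clear; lia.
  have eS i : A i :\: S i :|: S i = A i.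
    by apply/setP=> z; rewrite !in_setU in_setD; have /implyP := subsetP (sS i) z; mem_cases.
  exists (fun i => A i :\: S i), S, (~: Res); split.
  - split.
    + move=> i lti; apply: grown_clique => //; last exact: szS.
      have [lo [q [[a [b [_ _ cA _]]] _ _]]] := grA i lti.
      by apply: cliqueS cA; rewrite setUA subsetUr.
    + move=> i j ltij; rewrite !eS.
      apply: disjointWl (subsetUl _ (X i)) _; apply: disjointWr (subsetUl _ (X j)) _.
      exact: dY.
    + move=> i lti; rewrite eS disjoint_sym disjoints_subset; apply/subsetP=> z Az.
      by rewrite setCK; apply/ResP; exists i.
    + move=> z; case: (boolP (z \in Res)) => [/ResP[i lti Az]|nz]; last by left; rewrite inE.
      by right; exists i; rewrite ?eS.
  - rewrite mul0n addn0; apply/subset_leq_card/subsetP=> z.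
    rewrite in_setD in_setC => /andP[nz nRes]; rewrite in_setD nRes /=.
    case: (covB z) => // [[j ltj zj]]; case/negP: nz.
    by rewrite inE; apply/existsP; exists (Ordinal ltj).
  - move=> j /andP[_ ltj]; apply/subsetP=> z zj; rewrite in_setC; apply/negP.
    by move/(subsetP sRes) => Wz; rewrite (disjointFr (dWB j ltj) Wz) in zj.
  - move=> i lti; split; first exact: subsetDl.
    by rewrite cardsD (setIidPr (sS i)) szS //; clear; lia.
have [A0 [X0 [W0 [fam0 szW0 sW0 szA0]]]] := IH (ltnW lts).
have fam1 := family_insert (leqnn r) fam0 (grB s lts) (sW0 s ltac:(by rewrite leqnn)).
move: fam1; set A1 := (fun i => _); set X1 := (fun i => _) => fam1.
have A1_lt i : i < r -> A1 i = A0 i.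
  by move=> lti; rewrite /A1 ltn_eqF // /unbump ltnNge (ltnW lti) subn0.
have A1_r : A1 r = B s by rewrite /A1 eqxx.
have le_ts : 4 * d * s.+1 <= 4 * d * t by rewrite leq_mul2l lts orbT.
have leMA1 i : i < r.+1 -> M <= #|A1 i|.
  rewrite ltnS leq_eqVlt => /predU1P[->|lti]; first by rewrite A1_r; apply: leB.
  rewrite A1_lt //; have [_] := szA0 i lti; have := leA i lti; move: le_ts.
  by rewrite mulnS; clear; lia.
have [|p [q [e [e' [/andP[ltpq ltq] le le' dee']]]]] := family_crossing unifH propf no_blue fam1 er.
  by move=> i; rewrite -er => /leMA1; apply: leq_trans; rewrite er.
rewrite -er in ltq; move: ltq; rewrite ltnS leq_eqVlt => /predU1P[eqr|ltqr]; last first.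
  have linkS e0 : link c d.+1 A1 p q e0 -> link c d.+1 A p q e0.
    have sub l : l <= q -> A1 l \subset A l.
      by move=> lel; rewrite A1_lt; [case: (szA0 l _) => //|]; apply: leq_ltn_trans ltqr.
    move=> [ce sze eA [x xe xA] [y ye yA]]; split=> //.
    - by move=> z /eA[l lel zl]; exists l => //; apply: (subsetP (sub l lel)).
    - by exists x => //; apply: (subsetP (sub p (ltnW ltpq))).
    - by exists y => //; apply: (subsetP (sub q (leqnn q))).
  (* The contradiction comes from the original family, whose blobs still have their large bodies. *)
  case: (r) ltqr famA leA bigA => // r0 ltqr famA' leA' bigA'.
  have [||A2 [X2 [W3 [fam2 sA2 _ [i lti szi]]]]] :=
      family_merge d_gt1 no_red famA' _ _ (linkS _ le) (linkS _ le') dee'.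
  - by move=> i /leA'; move: leM'; clear; lia.
  - by rewrite ltpq.
  have := bigA' p q; rewrite ltpq ltqr => /(_ isT).
  have [gr2 _ _ _] := fam2; have := grown_card d_gt1 no_red (gr2 i lti).
  have [_] := sA2 i lti; have := leA' (bump q i) ltac:(rewrite /bump; nlia).
  have : 4 * d * (i < q) <= 4 * d by case: (i < q); rewrite ?muln0 ?muln1.
  by move: szi leM' d_gt1; clear; lia.
rewrite eqr {q eqr} in ltpq le le' *.
have [||A2 [X2 [W3 [fam2 sA2 [sW3 szW3] _]]]] :=
  family_merge d_gt1 no_red fam1 _ _ le le' dee'.
- by move=> i /leMA1; apply: leq_trans.
- by rewrite ltpq ltnSn.
exists A2, X2, W3; split=> //.
- set D := W0 :\: (B s :|: Z s) in sW3 szW3.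
  have sub : W3 :\: Rest s.+1 \subset (W0 :\: Rest s) :|: (W3 :\: D).
    apply/subsetP=> z; rewrite in_setU !in_setD => /andP[nz ->]; rewrite andbT.
    case: (boolP ((z \notin B s :|: Z s) && (z \in W0))) => [/andP[nzs ->]|_]; last by rewrite orbT.
    rewrite orbF andbT; apply/negP=> /RestP[j [lej ltj zj]]; case/negP: nz.
    rewrite inE; apply/existsP; exists (Ordinal ltj); rewrite zj andbT /= ltn_neqAle lej andbT.
    by apply: contraNneq nzs => ->.
  apply: leq_trans (subset_leq_card sub) _; apply: leq_trans (leq_card_setU _ _) _.
  have := subset_leq_card sW3; rewrite (cardsD W3) (setIidPr sW3) mulSn.
  by move: szW3 szW0; clear; lia.
- move=> j /andP[ltsj ltj]; apply: subset_trans sW3; apply/subsetP=> z zj.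
  rewrite in_setD (subsetP (sW0 j _) _ zj) ?ltj ?(ltnW ltsj) // andbT; apply/negP=> zs.
  have := family_inj famB lts ltj zs zj; move: ltsj; clear; lia.
- move=> i lti; have e_b : bump r i = i by rewrite /bump leqNgt lti.
  have := sA2 i lti; rewrite e_b lti A1_lt // muln1 => -[s2 sz2].
  have [s0 sz0] := szA0 i lti; split; first exact: subset_trans s0.
  by rewrite mulnS; move: sz0 sz2; clear; lia.
Qed.

End Transfer.

(** * The final configuration *)

Section Stuck.

Variables (N : nat) (c : {set 'I_N} -> bool) (d : nat).
Hypothesis d_gt1 : 1 < d.
Variables (V : finType) (H : {set {set V}}) (chi : nat) (f : V -> 'I_chi).
Hypotheses (unifH : uniform d.+1 H) (propf : proper_col H f).

(** The class of [i0] goes to an independent set in [W :\: Z], the other classes to the cores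
    without [Z] and a few exceptional vertices. Short connections avoiding [Z] and absorbable paths
    are excluded, which rules out every red crossing edge. *)
Lemma blue_copy_of_stuck r (A : nat -> {set 'I_N}) (W Z : {set 'I_N}) (i0 : 'I_chi) tau :
  r.+1 = chi -> is_tau d #|[set v | f v == i0]| tau -> tau < #|W :\: Z| ->
  (forall i j, i < r -> j < r -> i != j -> [disjoint A i & A j]) ->
  (forall i, i < r -> [disjoint W & A i]) ->
  (forall i, i < r -> #|V| + 2 ^ #|V| + #|Z| <= #|A i|) ->
  (forall i j U x y a, i < r -> j < r -> i != j -> 0 < a <= 2 -> flex c d U x y a a ->
     x \in A i -> y \in A j -> (forall z, z \in U -> z \in W \/ exists2 l, l < r & z \in A l) ->
     ~~ [disjoint U & Z]) ->
  (forall i U x y a z, i < r -> 0 < a <= 2 -> flex c d U x y a a ->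
     x \in A i -> y \in A i -> U \subset W :|: A i -> z \in U -> z \notin W) ->
  mono_copy H c false.
Proof.
move=> er [_ tau_max] lt_tau dA dWA leA no_conn no_ear.
pose n1 := #|W :\: Z|; pose phi (g : {set 'I_n1}) : {set 'I_N} := enum_val @: g.
have inj_ev : injective (enum_val : 'I_n1 -> 'I_N) by exact: enum_val_inj.
have phiW g z : z \in phi g -> (z \in W) && (z \notin Z).
  by case/imsetP=> u _ ->; have := enum_valP u; rewrite inE andbC.
have WA z i : i < r -> z \in W -> z \notin A i.
  by move=> lti Wz; rewrite (disjointFr (dWA i lti) Wz).
have AWx i z g : i < r -> z \in A i -> z \notin phi g.
  by move=> lti Az; apply/negP=> /phiW/andP[/(WA _ _ lti)]; rewrite Az.
have szphi g : #|phi g| = #|g| by rewrite card_imset.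
pose E := [set g : {set 'I_n1} | (#|g| == d) &&
  [exists i : 'I_r, 1 < #|[set b in A i :\: Z | c (b |: phi g)]|]].
have flexE (g : {set 'I_n1}) i b w : #|g| = d -> i < r -> b \in A i -> c (b |: phi g) ->
    w \in phi g -> flex c d (b |: phi g) b w 1 1.
  move=> szg lti Ab cb gw; apply: flex_edge => //; rewrite ?inE ?eqxx ?gw ?orbT //.
    by rewrite cardsU1 szphi szg (AWx i).
  by apply: contraTneq gw => <-; apply: (AWx i).
have E3 g h : g \in E -> h \in E -> g != h -> #|g :&: h| != 1.
  rewrite !inE => /andP[/eqP szg /existsP[i /card_gt1P[b1 [_ [Bb1 _ _]]]]].
  move=> /andP[/eqP szh /existsP[j /card_gt1P[b2' [b2'' [Bb2' Bb2'' nb2]]]]] _.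
  (* The edge [h] has two partners in its core, so one differs from [b1]; hence the bound [1 <] in
     [E]. *)
  have [b2 Bb2 nb12] : exists2 b2, b2 \in [set b in A j :\: Z | c (b |: phi h)] & b1 != b2.
    have [eb|nb] := eqVneq b1 b2'; last by exists b2'.
    by exists b2''; rewrite // eb.
  move: Bb1 Bb2; rewrite !inE => /andP[/andP[nZ1 A1] c1] /andP[/andP[nZ2 A2] c2].
  apply/negP=> /cards1P[u eu].
  have ephi : phi g :&: phi h = [set enum_val u].
    by rewrite -imsetI ?eu ?imset_set1 // => ? ? _ _; apply: inj_ev.
  have /setIP[gu hu] : enum_val u \in phi g :&: phi h by rewrite ephi set11.
  have fU : flex c d ((b1 |: phi g) :|: (b2 |: phi h)) b1 b2 2 2.
    have f1 := flexE g i b1 _ szg (ltn_ord i) A1 c1 gu.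
    have f2 := flex_rev (flexE h j b2 _ szh (ltn_ord j) A2 c2 hu).
    apply: flex_cat f1 f2 => //; rewrite -ephi; apply/subsetP=> z; rewrite !in_setI !in_setU1.
    case/andP=> /predU1P[->|gz] /predU1P[ez|hz].
    - by rewrite ez eqxx in nb12.
    - by rewrite (negPf (AWx i _ _ (ltn_ord i) A1)) in hz.
    - by rewrite ez (negPf (AWx j _ _ (ltn_ord j) A2)) in gz.
    - by rewrite gz hz.
  have sU z : z \in (b1 |: phi g) :|: (b2 |: phi h) ->
      [|| z == b1, z == b2 | (z \in W) && (z \notin Z)].
    by rewrite in_setU !in_setU1 => /orP[/orP[->|/phiW->]|/orP[->|/phiW->]]; rewrite ?orbT.
  have Wu : enum_val u \in W by case/andP: (phiW _ _ gu).
  have Uu : enum_val u \in (b1 |: phi g) :|: (b2 |: phi h) by rewrite !inE gu orbT.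
  (* The two red edges meet only in [u]. They form an absorbable path if the cores coincide, and
     otherwise a connection avoiding [Z]. *)
  have [eij|nij] := eqVneq i j.
    rewrite -eij in A2; move: Wu; apply/negP.
    apply: (no_ear i _ b1 b2 2 _ (ltn_ord i) isT fU A1 A2 _ Uu).
    apply/subsetP=> z /sU; rewrite in_setU.
    by case/or3P=> [/eqP->|/eqP->|/andP[->]]; rewrite ?A1 ?A2 ?orbT.
  have /negP[] : ~~ [disjoint (b1 |: phi g) :|: (b2 |: phi h) & Z].
    apply: (no_conn i j _ b1 b2 2 (ltn_ord i) (ltn_ord j) nij isT fU A1 A2) => z.
    by move=> /sU/or3P[/eqP->|/eqP->|/andP[Wz _]]; [right; exists i|right; exists j|left].
  rewrite disjoints_subset; apply/subsetP=> z /sU; rewrite in_setC.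
  by case/or3P=> [/eqP->|/eqP->|/andP[_]].
have [S indS leS] : exists2 S : {set 'I_n1}, independent E S & #|[set v | f v == i0]| <= #|S|.
  apply: NNPP => noS; move: lt_tau; rewrite ltnNge => /negP; apply.
  apply: (tau_max _ E); split=> // [g|S indS]; first by rewrite inE => /andP[/eqP].
  by rewrite ltnNge; apply/negP=> leS; apply: noS; exists S.
have [S' sS' szS'] := subset_of_card leS.
pose D i (g : {set 'I_n1}) := [set b in A i :\: Z | (#|g| == d) && c (b |: phi g)].
have szD i (g : {set 'I_n1}) : i < r -> g \subset S' -> #|D i g| <= 1.
  move=> lti sg; rewrite leqNgt; apply/negP=> gt1.
  have szg : #|g| == d.
    by case/card_gt1P: gt1 => b [_ [+ _ _]]; rewrite inE => /and3P[].
  suff /indS/negP : g \in E by apply; apply: subset_trans sS'.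
  rewrite inE szg; apply/existsP; exists (Ordinal lti); apply: leq_trans gt1 _.
  by apply/subset_leq_card/subsetP=> b; rewrite !inE => /and3P[-> _ ->].
(* By independence each subset of [S'] has at most one red partner in a core; these partners are
   removed from the core. *)
pose Bad i := cover [set D i g | g in powerset S'].
have szBad i : i < r -> #|Bad i| <= 2 ^ #|V|.
  move=> lti; apply: leq_trans (leq_card_cover _) _.
  apply: (@leq_trans (\sum_(B in [set D i g | g in powerset S']) 1)).
    by apply: leq_sum => B /imsetP[g]; rewrite powersetE => /szD-/(_ i lti)+ ->.
  rewrite sum1_card; apply: leq_trans (leq_imset_card _ _) _.
  by rewrite card_powerset szS' leq_exp2l // max_card.
pose T j := if j == nat_of_ord i0 then phi S' else A (unbump i0 j) :\: Z :\: Bad (unbump i0 j).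
have lt_un j : j < chi -> j != i0 -> unbump i0 j < r.
  by rewrite /unbump; have := ltn_ord i0; move: er; clear; lia.
have TZ z j : z \in T j -> z \notin Z.
  by rewrite /T; case: eqP => _; [case/phiW/andP|rewrite !inE => /and3P[]].
have TA z j : z \in T j -> j != i0 -> z \in A (unbump i0 j).
  by rewrite /T => + nj; rewrite (negPf nj) !inE => /and3P[].
apply: NNPP => no_blue.
have [||e [ce sze eT [i [j [ltij [[x xe Tx] [y ye Ty]]]]]]] :=
    @crossing_edge N c d.+1 V H unifH no_blue chi f T propf.
- move=> i j ltij; rewrite disjoints_subset; apply/subsetP=> z zi; rewrite in_setC.
  apply/negP=> zj; have [lti ltj] : i < chi /\ j < chi by move: ltij; clear; lia.
  have [ei|ni] := eqVneq i (nat_of_ord i0); have [ej|nj] := eqVneq j (nat_of_ord i0).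
  + by rewrite ei ej ltnn in ltij.
  + have := TA z j zj nj; apply/negP; move: zi; rewrite /T ei eqxx => /phiW/andP[Wz _].
    exact/WA/Wz/lt_un.
  + have := TA z i zi ni; apply/negP; move: zj; rewrite /T ej eqxx => /phiW/andP[Wz _].
    exact/WA/Wz/lt_un.
  + have neij : unbump i0 i != unbump i0 j.
      by apply/eqP; move: ni nj ltij; rewrite /unbump; clear; lia.
    have := TA z j zj nj.
    by rewrite (disjointFr (dA _ _ (lt_un i lti ni) (lt_un j ltj nj) neij) (TA z i zi ni)).
- move=> i; rewrite /T; case: eqP => [/val_inj->|/eqP ni]; first by rewrite szphi szS'.
  have lti := lt_un i (ltn_ord i) ni; have := leA _ lti; have := szBad _ lti.
  rewrite cardsD (cardsD (A _)).
  have := subset_leq_card (subsetIr (A (unbump i0 i) :\: Z) (Bad (unbump i0 i))).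
  have := subset_leq_card (subsetIr (A (unbump i0 i)) Z).
  by have := max_card [set v | f v == i]; clear; lia.
have eZ : [disjoint e & Z].
  rewrite disjoints_subset; apply/subsetP=> z /eT[l _]; rewrite in_setC; exact: TZ.
have eWA z : z \in e -> z \in W \/ exists2 l, l < r & z \in A l.
  move=> /eT[l ltl Tz]; have [el|nl] := eqVneq l (nat_of_ord i0).
    by left; move: Tz; rewrite /T el eqxx => /phiW/andP[].
  by right; exists (unbump i0 l); [apply: lt_un|apply: TA].
have no_two l l' u v : l < r -> l' < r -> l != l' -> u \in e -> v \in e ->
    u \in A l -> v \in A l' -> False.
  move=> ltl ltl' nl ue ve Au Av; have nuv : u != v.
    apply/eqP=> euv; rewrite -euv in Av.
    by rewrite (disjointFr (dA l l' ltl ltl' nl) Au) in Av.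
  have /negP[] : ~~ [disjoint e & Z] := no_conn l l' e u v 1 ltl ltl' nl isT
    (flex_edge d_gt1 ce sze ue ve nuv) Au Av eWA.
  exact: eZ.
have [l [ltl [u ue Tu] [v ve Sv]]] : exists l, [/\ l < r,
    exists2 u, u \in e & u \in A l :\: Z :\: Bad l & exists2 v, v \in e & v \in phi S'].
  have [lti ltj] : i < chi /\ j < chi by move: ltij; clear; lia.
  have [ei|ni] := eqVneq i (nat_of_ord i0); have [ej|nj] := eqVneq j (nat_of_ord i0).
  + by move: ltij; rewrite ei ej ltnn.
  + exists (unbump i0 j); split; first exact: lt_un.
      by exists y => //; move: Ty; rewrite /T (negPf nj).
    by exists x => //; move: Tx; rewrite /T ei eqxx.
  + exists (unbump i0 i); split; first exact: lt_un.
      by exists x => //; move: Tx; rewrite /T (negPf ni).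
    by exists y => //; move: Ty; rewrite /T ej eqxx.
  + case: (no_two (unbump i0 i) (unbump i0 j) x y); rewrite ?lt_un ?TA //.
    by move: ni nj ltij; rewrite /unbump; clear; lia.
have [Au nBad] : u \in A l /\ u \notin Bad l by move: Tu; rewrite !inE => /and3P[].
have eS z : z \in e -> z \notin A l -> z \in phi S'.
  move=> ze nz; have [k ltk Tz] := eT z ze; have [ek|nk] := eqVneq k (nat_of_ord i0).
    by move: Tz; rewrite /T ek eqxx.
  have Az := TA z k Tz nk; have nlk : l != unbump i0 k by apply: contraNneq nz => ->.
  by case: (no_two l _ u z ltl (lt_un k ltk nk) nlk ue ze Au Az).
(* A second core vertex would make [e] an absorbable path through [v], which lies in [W]. *)
have only_u z : z \in e -> z \in A l -> z = u.
  move=> ze Az; apply/eqP; apply: contraT => nzu.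
  have /andP[Wv _] := phiW _ _ Sv; move: Wv; apply/contraLR => _.
  apply: (no_ear l e z u 1 _ ltl isT (flex_edge d_gt1 ce sze ze ue nzu) Az Au _ ve).
  apply/subsetP=> w we; rewrite in_setU; have [Aw|nAw] := boolP (w \in A l).
    by rewrite orbT.
  by have /andP[-> _] := phiW _ _ (eS w we nAw).
pose g := enum_val @^-1: (e :\ u) : {set 'I_n1}.
have phig : phi g = e :\ u.
  apply/setP=> z; apply/imsetP/idP=> [[w]|zeu]; first by rewrite inE => + ->.
  have /imsetP[w _ ez] : z \in phi S'.
    move: zeu; rewrite !inE => /andP[nzu ze]; apply: eS => //.
    by apply: contra nzu => /(only_u z ze)->.
  by exists w; rewrite // inE -ez.
(* Now [e] is [u] together with a [d]-subset of [S'], so [u] is one of the removed partners. *)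
case/negP: nBad; apply/bigcupP; exists (D l g).
  apply: imset_f; rewrite powersetE; apply/subsetP=> w; rewrite !inE => /andP[nw we].
  have /imsetP[w' Sw' /inj_ev->//] : enum_val w \in phi S'.
  by apply: eS => //; apply: contra nw => /(only_u _ we)->.
rewrite inE; apply/and3P; split.
- by case/setDP: Tu.
- by apply/eqP; rewrite -szphi phig; have := cardsD1 u e; rewrite ue sze; clear; lia.
- by rewrite phig setD1K.
Qed.

End Stuck.

(** * Absorbing uncovered vertices, and the count against [tau] *)

Section Final.

Variables (N : nat) (c : {set 'I_N} -> bool) (d m : nat).
Hypothesis d_gt1 : 1 < d.
Hypothesis no_red : ~ mono_copy (loose_cycle d.+1 (m * d)) c true.

Lemma grown_length s A X : grown c d m s A X -> 24 * d <= #|A| ->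
  exists lo q, [/\ blob c d A X lo q, 3 * lo <= q + s & q + 24 < m].
Proof.
move=> grA leA; have [lo [q [bA lelo _]]] := grA; exists lo, q; split=> //.
have := grown_card d_gt1 no_red grA ltac:(move: leA; clear; lia).
have [a [b [[szX _] _ _ _]]] := bA; rewrite szX => ltm.
have : (q + 24) * d < m * d by move: ltm leA; clear; lia.
by rewrite ltn_pmul2r // ltnW.
Qed.

(** Each of the other [r - 1] blobs has fewer than [m * d] vertices; the rest of the vertex set is
    left to [W] and blob [i]. *)
Lemma family_large s r A X W i : family c d m s r A X W -> i < r ->
  (forall l, l < r -> d <= #|A l|) -> r * (m * d - 1) < N ->
  m * d <= #|W| + (#|A i| + #|X i|).
Proof.
move=> famA lti leA ltN; have [grA _ _ covA] := famA.
have : #|'I_N| <= #|W :|: (A i :|: X i)| + r.-1 * (m * d - 1).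
  apply: (@card_cover_le _ _ (fun j => A (bump i j) :|: X (bump i j))) => [x|j ltj].
    case: (covA x) => [Wx|[l ltl xl]]; first by left; rewrite inE Wx.
    have [eli|nli] := eqVneq l i; first by left; rewrite -eli in_setU xl orbT.
    right; exists (unbump i l); first by rewrite /unbump; move: nli lti ltl; clear; lia.
    by rewrite unbumpK.
  have ltb : bump i j < r by rewrite /bump; move: ltj lti; clear; lia.
  apply: leq_trans (leq_card_setU _ _) _.
  by have := grown_card d_gt1 no_red (grA _ ltb) (leA _ ltb); clear; lia.
rewrite card_ord; have [+ _] := leq_card_setU W (A i :|: X i).
have [+ _] := leq_card_setU (A i) (X i).
have : r * (m * d - 1) = (m * d - 1) + r.-1 * (m * d - 1).
  by rewrite -mulSn prednK //; case: (r) lti.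
by move: ltN; clear; lia.
Qed.

(** Both length bounds grow by [1 + a], so [3 * lo <= q + s] needs [2 * (1 + a)] more slack, which
    is at most [6] as [a <= 2]. *)
Lemma family_absorb s r A X W i U x y a z : family c d m s r A X W -> i < r ->
  24 * d <= #|A i| -> s <= m -> flex c d U x y a a -> 0 < a <= 2 ->
  x \in A i -> y \in A i -> U \subset W :|: A i -> z \in U -> z \in W ->
  exists A' X' W', [/\ family c d m (s + 6) r A' X' W', #|W'| < #|W| &
    forall l, l < r -> #|A l| <= #|A' l| + 4 * d].
Proof.
move=> famA lti leA les fU /andP[a_gt0 lea] Ax Ay sU Uz Wz.
have [grA dY dW covA] := famA; have [lo [q [bA lelo ltq]]] := grown_length (grA i lti) leA.
have szU : #|U| <= 2 * d + 1.
  by have [-> _] := fU; rewrite leq_add2r leq_mul2r lea orbT.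
have UX v l : v \in U -> l < r -> v \notin X l.
  move=> /(subsetP sU) + ltl; rewrite in_setU => /orP[Wv|Av].
    by have := disjointFr (dW l ltl) Wv; rewrite in_setU => /norP[].
  exact: family_core_body famA lti ltl Av.
have UA v l : v \in U -> l < r -> l != i -> v \notin A l.
  move=> /(subsetP sU) + ltl nli; rewrite in_setU => /orP[Wv|Av].
    by have := disjointFr (dW l ltl) Wv; rewrite in_setU => /norP[].
  apply: contra nli => Alv; apply/eqP.
  by apply: (family_inj (x := v) famA) => //; rewrite inE ?Alv ?Av.
have szAU : #|A i| <= #|A i :\: U| + (2 * d + 1).
  rewrite -(cardsID U (A i)); have := subset_leq_card (subsetIr (A i) U).
  by move: szU; clear; lia.
have [|||F [sF cF bF]] := blob_absorb d_gt1 bA fU _ Ax Ay.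
- by rewrite a_gt0 leqnn.
- by rewrite disjoints_subset; apply/subsetP=> v Uv; rewrite inE UX.
- by move: szAU leA d_gt1; clear; lia.
set B := A i :\: U :\: F in bF; set Y := X i :|: U :|: F in bF.
have eBY : B :|: Y = A i :|: X i :|: U.
  apply/setP=> v; have /implyP := subsetP sF v.
  by rewrite !in_setU !in_setD; mem_cases.
exists (fun l => if l == i then B else A l), (fun l => if l == i then Y else X l), (W :\: U).
split.
- split.
  + move=> l ltl; case: eqP => _.
      exists (lo + 1 + a), (q + 1 + a); split=> //; move: lelo ltq les lea; clear; lia.
    have [lo' [q' [b' le' lt']]] := grA l ltl; exists lo', q'; split=> //.
    by move: le'; clear; lia.
  + have dis l : l < r -> l != i -> [disjoint A l :|: X l & A i :|: X i :|: U].
      move=> ltl nli; rewrite disjoints_subset; apply/subsetP=> v vl; rewrite in_setC in_setU.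
      apply/norP; split; first by apply: contra nli => vi; rewrite (family_inj famA ltl lti vl vi).
      apply/negP=> Uv; move: vl.
      by rewrite in_setU (negPf (UX v l Uv ltl)) (negPf (UA v l Uv ltl nli)).
    move=> l l' /andP[ltll' ltl']; have ltl := ltn_trans ltll' ltl'.
    case: eqP => [el|/eqP nl]; case: eqP => [el'|/eqP nl'].
    * by rewrite el el' ltnn in ltll'.
    * by rewrite eBY disjoint_sym; apply: dis.
    * by rewrite eBY; apply: dis.
    * by apply: dY; rewrite ltll'.
  + move=> l ltl; rewrite disjoints_subset; apply/subsetP=> v; rewrite in_setD in_setC.
    case/andP=> nU Wv; case: eqP => [el|_]; last by rewrite (disjointFr (dW l ltl) Wv).
    by rewrite eBY in_setU (negPf nU) orbF (disjointFr (dW i lti) Wv).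
  + move=> v; have [Uv|nU] := boolP (v \in U).
      by right; exists i; rewrite // eqxx eBY in_setU Uv orbT.
    case: (covA v) => [Wv|[l ltl vl]]; first by left; rewrite in_setD nU.
    right; exists l => //; case: eqP => [el|//].
    by rewrite eBY in_setU -el vl.
- apply: proper_card; apply/properP; split; first exact: subsetDl.
  by exists z; rewrite // in_setD Uz.
move=> l ltl; case: eqP => [->|_]; last exact: leq_addr.
rewrite /B cardsD (setIidPr sF) cF.
by move: szAU d_gt1 (subset_leq_card sF); rewrite cF; clear; lia.
Qed.

(** Splicing along the two connections loses at most [d] vertices, so the result has at least
    [m * d]. Its lower bound stays below [m] thanks to [2 * s <= m], and a red cycle appears. *)
Lemma family_pair s r A X W i j U U' x y x' y' a b : family c d m s r A X W ->
  i < j < r -> 30 * d <= #|A i| -> 30 * d <= #|A j| -> 2 * s <= m ->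
  m * d + d <= #|A i| + #|X i| + (#|A j| + #|X j|) ->
  flex c d U x y a a -> flex c d U' x' y' b b -> 0 < a <= 2 -> 0 < b <= 2 ->
  x \in A i -> y \in A j -> x' \in A i -> y' \in A j -> [disjoint U & U'] ->
  (forall z, z \in U :|: U' -> z \in W \/ exists2 l, l < r & z \in A l) -> False.
Proof.
move=> famA /andP[ltij ltj] leAi leAj les leY fU fU' /andP[a_gt0 lea] /andP[b_gt0 leb].
move=> Ax Ay Ax' Ay' dUU' sU; have lti := ltn_trans ltij ltj.
have [grA dY dW covA] := famA.
have [lo [q [bi le_lo lt_q]]] := grown_length (grA i lti) ltac:(move: leAi; clear; lia).
have [lo' [q' [bj le_lo' lt_q']]] := grown_length (grA j ltj) ltac:(move: leAj; clear; lia).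
have UX v l : v \in U :|: U' -> l < r -> v \notin X l.
  move=> /sU[Wv|[k ltk Av]] ltl; last exact: family_core_body famA ltk ltl Av.
  by have := disjointFr (dW l ltl) Wv; rewrite in_setU => /norP[].
have szUU' : #|U :|: U'| <= 4 * d + 2.
  apply: leq_trans (leq_card_setU _ _) _; have [-> _] := fU; have [-> _] := fU'.
  have : a * d <= 2 * d by rewrite leq_mul2r lea orbT.
  by have : b * d <= 2 * d; [rewrite leq_mul2r leb orbT|clear; lia].
have szD l : #|A l| <= #|A l :\: (U :|: U')| + (4 * d + 2).
  rewrite -(cardsID (U :|: U') (A l)).
  by have := subset_leq_card (subsetIr (A l) (U :|: U')); move: szUU'; clear; lia.
have [||||A1 [X1 [L [q1 [b1 _ [sA1 szA1] [szL _ _] eU]]]]] :=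
  blob_splice d_gt1 bi bj fU (flex_rev fU') a_gt0 b_gt0 (And4 Ax Ax' Ay Ay') dUU'.
- by rewrite disjoints_subset; apply/subsetP=> v Uv; rewrite inE in_setU negb_or !UX.
- by apply: dY; rewrite ltij.
- by move: (szD i) leAi d_gt1; clear; lia.
- by move: (szD j) leAj d_gt1; clear; lia.
apply: no_red; apply: blob_cycle b1 _ _ _ => //.
- by move: le_lo lt_q le_lo' lt_q' les lea leb; clear; lia.
- move: szA1 leAi d_gt1 szUU'; have := subset_leq_card (subsetIr (A i) (U :|: U')).
  by clear; lia.
have : #|(A i :|: X i) :|: (A j :|: X j)| <= #|A1 :|: X1 :|: L|.
  rewrite eU; apply/subset_leq_card/subsetP=> z; rewrite !in_setU.
  by case/orP=> /orP[->|->]; rewrite ?orbT.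
have disj l : l < r -> #|A l :|: X l| = #|A l| + #|X l|.
  move=> ltl; rewrite cardsU disjoint_setI0 ?cards0 ?subn0 // disjoints_subset.
  by apply/subsetP=> z Az; rewrite inE (family_core_body famA ltl ltl Az).
rewrite cardsU disjoint_setI0 ?cards0 ?subn0 ?disj //; last by apply: dY; rewrite ltij.
have [+ _] := leq_card_setU (A1 :|: X1) L; have [+ _] := leq_card_setU A1 X1.
by move: szL leY; clear; lia.
Qed.

Variables (V : finType) (H : {set {set V}}) (chi : nat) (f : V -> 'I_chi).
Hypotheses (unifH : uniform d.+1 H) (propf : proper_col H f).
Hypothesis no_blue : ~ mono_copy H c false.

(** Induction on [#|W|]. An absorption shrinks [W] and costs [6] units of slack and at most [4 * d]
    vertices of a core, for which the terms in [#|W|] pay. If none is possible, the configuration is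
    stuck and yields a blue copy. *)
Lemma no_family r (i0 : 'I_chi) tau s A X W L S0 :
  r.+1 = chi -> is_tau d #|[set v | f v == i0]| tau ->
  r * (m * d - 1) + (2 * d + 1) * 'C(r, 2) + tau < N ->
  #|V| + 2 ^ #|V| + (2 * d + 1) * 'C(r, 2) + 30 * d <= L ->
  2 * S0 + 2 * d + 2 <= m ->
  family c d m s r A X W -> s + 6 * #|W| <= S0 ->
  (forall i, i < r -> L + 4 * d * #|W| <= #|A i|) -> False.
Proof.
move=> er tau_is ltN leL leS0.
have [w] := ubnP #|W|; elim: w s A X W => // w IH s A X W ltw famA les leA.
have [grA dY dW covA] := famA.
have leA' i : i < r -> 30 * d <= #|A i| by move=> /leA; move: leL; clear; lia.
have ltN' : r * (m * d - 1) < N by move: ltN; clear; lia.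
have leAd l : l < r -> d <= #|A l| by move=> /leA'; clear; lia.
pose conn i j (U : {set 'I_N}) := exists x y a,
  [/\ 0 < a <= 2, flex c d U x y a a, x \in A i, y \in A j &
    forall z, z \in U -> z \in W \/ exists2 l, l < r & z \in A l].
have [|Z szZ hZ] := @pick_links _ r (2 * d + 1) conn.
  move=> i j U [x [y [a [/andP[_ lea] [-> _] _ _ _]]]].
  by rewrite leq_add2r leq_mul2r lea orbT.
(* A connection avoiding [Z] is disjoint from the stored one for its pair, and two large blobs with
   two disjoint connections give a red cycle. *)
have no_conn i j U : i < j < r -> conn i j U -> ~~ [disjoint U & Z].
  move=> ltij connU; apply/negP=> dUZ.
  have [U0 sU0 [x' [y' [b [leb fU0 Ax' Ay' sU0A]]]]] := hZ i j U ltij connU.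
  have [x [y [a [lea fU Ax Ay sUA]]]] := connU.
  have [lti ltj] : i < r /\ j < r by move: ltij; clear; lia.
  apply: (family_pair famA ltij (leA' i lti) (leA' j ltj) _ _ fU fU0 lea leb Ax Ay Ax' Ay').
  - by move: les leS0; clear; lia.
  - have := family_large famA lti leAd ltN'; have := family_large famA ltj leAd ltN'.
    have : m <= m * d by rewrite leq_pmulr // ltnW.
    by move: les leS0; clear; lia.
  - exact: disjointWr dUZ.
  - by move=> z; rewrite in_setU => /orP[/sUA|/sU0A].
apply: no_blue; apply: (@blue_copy_of_stuck N c d d_gt1 V H chi f unifH propf r A W Z i0 tau) => //.
- have : #|'I_N| <= #|W| + r * (m * d - 1).
    apply: (@card_cover_le _ _ (fun i => A i :|: X i)) => // i lti.
    apply: leq_trans (leq_card_setU _ _) _.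
    by have := grown_card d_gt1 no_red (grA i lti) (leAd i lti); clear; lia.
  rewrite card_ord cardsD; have := subset_leq_card (subsetIr W Z).
  by move: ltN szZ; clear; lia.
- move=> i j lti ltj nij; rewrite disjoints_subset; apply/subsetP=> z Az; rewrite in_setC.
  apply: contra nij => Az'; apply/eqP.
  by apply: (family_inj (x := z) famA) => //; rewrite inE ?Az ?Az'.
- by move=> i lti; apply: disjointWr (dW i lti); apply: subsetUl.
- by move=> i /leA; move: leL szZ; clear; lia.
- move=> i j U x y a lti ltj nij lea fU Ax Ay sU.
  have [ltij|ltji|eij] := ltngtP i j; last by rewrite eij eqxx in nij.
    by apply: (no_conn i j); rewrite ?ltij //; exists x, y, a.
  by apply: (no_conn j i); rewrite ?ltji //; exists y, x, a; split=> //; apply: flex_rev.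
move=> i U x y a z lti lea fU Ax Ay sU Uz; apply/negP=> Wz.
have [||A' [X' [W' [famA' ltW szA']]]] := family_absorb famA lti _ _ fU lea Ax Ay sU Uz Wz.
- by move: (leA' i lti); clear; lia.
- by move: les leS0; clear; lia.
apply: (IH (s + 6) A' X' W') => //.
- by move: ltW ltw; clear; lia.
- by move: les ltW; clear; lia.
move=> l ltl; have := szA' l ltl; have := leA l ltl.
have : 4 * d * #|W'|.+1 <= 4 * d * #|W| by rewrite leq_mul2l ltW orbT.
by rewrite mulnS; clear; lia.
Qed.

End Final.

(** * The theorem *)

Lemma chi_le_card (V : finType) (H : {set {set V}}) k chi :
  1 < k -> uniform k H -> is_chi H chi -> chi <= #|V|.
Proof.
move=> k_gt1 unifH [_ min_chi]; apply: (min_chi _ enum_rank) => e /unifH sze.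
have /card_gt1P[x [y [xe ye nxy]]] : 1 < #|e| by rewrite sze.
by exists x, y; rewrite (inj_eq enum_rank_inj).
Qed.

Theorem theorem1p9 (k : nat) (V : finType) (H : {set {set V}}) :
  3 <= k -> uniform k H ->
  exists n0 : nat, forall n : nat, n0 <= n -> n %% (k - 1) = 0 ->
    forall chi sigma tau : nat,
      is_chi H chi -> is_sigma H sigma -> is_tau (k - 1) sigma tau ->
      ramsey_le (loose_cycle k n) H
        ((chi - 1) * (n - 1) + 4 * k * 'C(chi - 1, 2) + tau + 1).
Proof.
case: k => // d; rewrite ltnS => d_gt1 unifH; pose h := #|V|.
(* The constants are found backwards: cores of size [M1] in the second run leave at most [wmax]
   vertices uncovered, the hubs have size [M2], large against [wmax], and [R2], which bounds what
   the first run leaves, enters only the bound on [n]. As [chi] comes after [n0], it is replaced by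
   [h]. *)
pose M1 := d.+1 * (h * h) + h + 24 * d.
have [R1 ram1] := ramsey_cliques d.+1 (M1 + 4 * d * h + (3 * d + 1)) h.
pose wmax := R1 + h * d.
pose L := h + 2 ^ h + (2 * d + 1) * (h * h) + 30 * d.
pose M2 := M1 + L + 4 * d * wmax + (3 * d + 1) + 4 * d * h.
have [R2 ram2] := ramsey_cliques d.+1 (M2 + 4 * d * h + (3 * d + 1)) h.
exists (d * (2 * R2 + 12 * wmax + 4 * d + 10)) => n + nd chi sigma tau chiH [chi' [chiH' [+ _]]].
rewrite subn1 /= in nd *; have [m em] : exists m, n = m * d.
  by exists (n %/ d); rewrite {1}(divn_eq n d) nd addn0.
rewrite em mulnC leq_pmul2r; last exact: ltnW.
move=> le_m; have echi : chi' = chi.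
  have [[f1 p1] min1] := chiH; have [[f2 p2] min2] := chiH'.
  by apply/eqP; rewrite eqn_leq (min1 _ _ p2) (min2 _ _ p1).
rewrite echi => -[f [propf [i0 szi0]]] tau_is {chi' chiH' echi}.
have le_chi : chi <= h by apply: chi_le_card unifH chiH; rewrite ltnS ltnW.
have chi_gt0 : 0 < chi by apply: leq_trans (ltn_ord i0).
pose r := chi - 1; have er : r.+1 = chi by rewrite /r; move: chi_gt0; clear; lia.
set N := (_ + 1); exists N; split=> // c; rewrite /N; set N' := (_ + 1) in c *.
apply: NNPP => no_copy.
have no_red : ~ mono_copy (loose_cycle d.+1 (m * d)) c true by move=> cp; apply: no_copy; left.
have no_blue : ~ mono_copy H c false by move=> cp; apply: no_copy; right.
have ltN : r * (m * d - 1) + (2 * d + 1) * 'C(r, 2) + tau < N'.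
  (* A connection of at most two edges has at most [2 * d + 1] vertices, within the [4 * k] granted
     per pair. *)
  have : (2 * d + 1) * 'C(r, 2) <= 4 * d.+1 * 'C(r, 2) by rewrite leq_mul2r; apply/orP; right; lia.
  by rewrite /N' -/r; clear; lia.
have le_bin s : s <= h -> 'C(s, 2) <= h * h.
  move=> les; have : s * s.-1 <= h * h by rewrite leq_mul // (leq_trans (leq_pred _)).
  by rewrite bin2; clear; lia.
have leM1 : d.+1 * 'C(chi, 2) + #|V| <= M1.
  have : d.+1 * 'C(chi, 2) <= d.+1 * (h * h) by rewrite leq_mul2l le_bin ?orbT.
  by rewrite /M1 -/h; clear; lia.
have le_dh : 4 * d * chi <= 4 * d * h by rewrite leq_mul2l le_chi orbT.
have cliques M R : (forall (T : finType) (c : {set T} -> bool) (X : {set T}), R <= #|X| ->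
    (exists Y : {set T}, [/\ Y \subset X, #|Y| = M + 4 * d * h + (3 * d + 1) &
       forall e : {set T}, e \subset Y -> #|e| = d.+1 -> c e]) \/
    (exists Y : {set T}, [/\ Y \subset X, #|Y| = h &
       forall e : {set T}, e \subset Y -> #|e| = d.+1 -> ~~ c e])) ->
    forall X : {set 'I_N'}, R <= #|X| -> exists Y : {set 'I_N'},
      [/\ Y \subset X, #|Y| = M + 4 * d * chi + (3 * d + 1) & clique c d Y].
  move=> ram X leX; case: (ram _ c X leX) => [[Y [sY szY cY]]|[Y [_ szY blueY]]].
    have [|Y' sY' szY'] := @subset_of_card _ Y (M + 4 * d * chi + (3 * d + 1)).
      by rewrite szY; move: le_dh; clear; lia.
    by exists Y'; split=> //; [apply: subset_trans sY|apply: cliqueS cY].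
  by case: no_blue; apply: blue_clique_copy unifH szY blueY.
have m_gt1 : 1 < m by move: le_m; clear; lia.
have [t [A [X [W [ltt famA _ ltW leA]]]]] := @family_bulk _ c d m d_gt1 m_gt1 no_red V H chi f
  unifH propf chi_gt0 no_blue M2 R2 set0 ltac:(move: leM1; rewrite /M2; clear; lia)
  ltac:(rewrite /M2 /M1; clear; lia) (cliques _ _ ram2).
rewrite setD0 in ltW.
have le_md : m <= m * d by rewrite leq_pmulr // ltnW.
have [grA _ dW covA] := famA.
have leAd i : i < t -> d <= #|A i| by move=> /leA; rewrite /M2 /M1; clear; lia.
(* A missing blob would leave about [m * d] vertices uncovered, more than [R2]. *)
have et : t = r.
  apply/eqP; rewrite eqn_leq -ltnS er ltt /= leqNgt; apply/negP=> lttr.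
  have : #|'I_N'| <= #|W| + t * (m * d - 1).
    apply: (@card_cover_le _ _ (fun i => A i :|: X i)) => // i lti.
    apply: leq_trans (leq_card_setU _ _) _.
    by have := grown_card d_gt1 no_red (grA i lti) (leAd i lti); clear; lia.
  rewrite card_ord; have : t.+1 * (m * d - 1) <= r * (m * d - 1) by rewrite leq_mul2r lttr orbT.
  by rewrite mulSn; move: ltN ltW le_m le_md; clear; lia.
rewrite {t}et in ltt famA leA grA dW covA leAd.
have ltN' : r * (m * d - 1) < N' by move: ltN; clear; lia.
have bigA p q : p < q < r -> m * d + d <= #|A p| + #|X p| + (#|A q| + #|X q|).
  move=> /andP[ltpq ltq]; have := family_large d_gt1 no_red famA ltq leAd ltN'.
  have := family_large d_gt1 no_red famA (ltn_trans ltpq ltq) leAd ltN'.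
  by move: ltW le_m le_md; clear; lia.
(* The hub cores are withheld from the second run. *)
pose Res := [set z | [exists i : 'I_r, z \in A i]].
have ResP z : z \in Res <-> exists2 i, i < r & z \in A i.
  rewrite inE; split=> [/existsP[i Az]|[i lti Az]]; first by exists i.
  by apply/existsP; exists (Ordinal lti).
have [t [B [Z [W2 [ltt2 famB sRes ltW2 leB]]]]] := @family_bulk _ c d m d_gt1 m_gt1 no_red V H chi f
  unifH propf chi_gt0 no_blue M1 R1 Res leM1 ltac:(rewrite /M1; clear; lia) (cliques _ _ ram1).
have le_t : 4 * d * t <= 4 * d * h by rewrite leq_mul2l (leq_trans (ltnW ltt2)) ?orbT.
have [||A' [X' [W' [famA' szW' szA']]]] := @family_transfer _ c d m d_gt1 m_gt1 no_red V H chi f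
  unifH propf no_blue r A X W t B Z W2 M1 Res er famA bigA famB ResP sRes leB _ leM1 _.
- by move=> i /leA; move: le_t; rewrite /M2; clear; lia.
- by rewrite /M1; clear; lia.
have leW' : #|W'| <= wmax.
  have : t * d <= h * d by rewrite leq_mul2r (leq_trans (ltnW ltt2)) ?orbT.
  by move: szW' ltW2; rewrite /wmax; clear; lia.
apply: (@no_family _ c d m d_gt1 no_red V H chi f unifH propf no_blue r i0 tau 0 A' X' W' L
  (6 * wmax)) => //.
- by rewrite szi0.
- rewrite /L !leq_add2r leq_add2l leq_mul2l le_bin ?orbT //.
  by move: er le_chi; clear; lia.
- by move: le_m; clear; lia.
- by rewrite leq_mul2l leW' orbT.
move=> i lti; have := szA' i lti; have := leA i lti.
have : 4 * d * #|W'| <= 4 * d * wmax by rewrite leq_mul2l leW' orbT.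
by move: le_t; rewrite /M2; clear; lia.
Qed.
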